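(* Let $T$ be an interface element (an arbitrary triangle if $N=2$, tetrahedron if $N=3$). Then for each $i=1,\dots,N+1$ there exists a unique function $\phi_{i,T}\in S_h(T)$ with $\mathcal N_{j,T}(\phi_{i,T})=\delta_{ij}$ for all $j=1,\dots,N+1$, and it is given explicitly by $$\phi_{i,T}(\mathbf x)=\lambda_{i,T}(\mathbf x)+\frac{(\beta_T^-/\beta_T^+-1)\,\nabla\lambda_{i,T}\cdot\mathbf n_h}{1+(\beta_T^-/\beta_T^+-1)\,|T_h^+|/|T|}\,\bigl(w(\mathbf x)-\Pi_Tw(\mathbf x)\bigr),\qquad i=1,\dots,N+1.$$
   Context: $N\in\{2,3\}$. An interface element $T$ is an open simplex in $\mathbb R^N$ (an element of a triangulation not fitted to the interface) that is cut by the discrete interface: $\Gamma_{h,T}=T\cap\Gamma_{h,T}^{ext}\neq\emptyset$, where $\Gamma_{h,T}^{ext}$ is a hyperplane of dimension $N-1$, splitting $T$ into two nonempty open parts $T_h^+$ and $T_h^-$. $\mathbf n_h$ is the constant unit vector perpendicular to $\Gamma_{h,T}$ pointing from $T_h^-$ to $T_h^+$. $[v]_{\Gamma_{h,T}}$ is the jump across $\Gamma_{h,T}$ (value from $T_h^+$ minus value from $T_h^-$). $|\cdot|$ is the measure of a set. $\mathbb P_1(D)$ is the set of polynomials of degree $\le 1$ on $D$. $F_1,\dots,F_{N+1}$ are the faces of $T$ (edges if $N=2$), $W(T)=\{v\in L^2(T): v|_{F_i}\in L^2(F_i),\ i=1,\dots,N+1\}$, and $\mathcal N_{i,T}(v)=\frac1{|F_i|}\int_{F_i}v$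 for $v\in W(T)$. $\lambda_{i,T}\in\mathbb P_1(T)$ is the Crouzeix–Raviart basis function, $\mathcal N_{j,T}(\lambda_{i,T})=\delta_{ij}$, and $\Pi_T:W(T)\to\mathbb P_1(T)$ is the Crouzeix–Raviart interpolation, $\mathcal N_{i,T}(\Pi_Tv)=\mathcal N_{i,T}(v)$ for $i=1,\dots,N+1$. $\beta_T^+,\beta_T^->0$ are constants, $\beta_T|_{T_h^\pm}=\beta_T^\pm$, and $$S_h(T)=\{\phi\in L^2(T):\ \phi|_{T_h^\pm}\in\mathbb P_1(T_h^\pm),\ [\phi]_{\Gamma_{h,T}}=0,\ [\beta_T\nabla\phi\cdot\mathbf n_h]_{\Gamma_{h,T}}=0\}.$$ The function $w$ on $T$ is $w=\mathrm{dist}(\cdot,\Gamma_{h,T}^{ext})$ on $T_h^+$ and $w=0$ on $T_h^-$. *)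

(* Defs.v *)
From HB Require Import structures.
From mathcomp Require Import all_boot all_order all_algebra.
From mathcomp Require Import all_classical all_reals all_analysis.

Set Implicit Arguments.
Unset Strict Implicit.
Unset Printing Implicit Defensive.

Import Order.TTheory GRing.Theory Num.Theory.
Import numFieldNormedType.Exports.

Local Open Scope classical_set_scope.
Local Open Scope ring_scope.

(** * Lebesgue measure on R^n, realised as ['rV[R]_n]

The sigma-algebra is the one generated by the coordinates (the Borel
sets), and the measure is defined by recursion on [n] as the image of the
product of the Lebesgue measure on R and that on R^n by [(r, x) |-> r :: x]. *)

Section measurable_row_vectors.
Context (R : realType) (n : nat).

Let coord (i : 'I_n) (x : 'rV[R]_n) : R := x 0 i.

Let rv_set0 : g_sigma_preimage coord set0.
Proof. exact: sigma_algebra0. Qed.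

Let rv_setC A : g_sigma_preimage coord A -> g_sigma_preimage coord (~` A).
Proof. exact: sigma_algebraC. Qed.

Let rv_bigcup (F : (set 'rV[R]_n)^nat) :
  (forall i, g_sigma_preimage coord (F i)) ->
  g_sigma_preimage coord (\bigcup_i F i).
Proof. exact: sigma_algebra_bigcup. Qed.

HB.instance Definition _ := @isMeasurable.Build default_measure_display
  'rV[R]_n (g_sigma_preimage coord) rv_set0 rv_setC rv_bigcup.

Lemma measurable_rv_coord (i : 'I_n) :
  measurable_fun [set: 'rV[R]_n] (fun x : 'rV[R]_n => x 0 i).
Proof.
move=> _ Y mY; rewrite setTI; apply: sub_sigma_algebra => /=.
rewrite -bigcup_seq/=; exists i => /=; first by rewrite mem_index_enum.
by exists Y => //; rewrite setTI.
Qed.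

Lemma measurable_fun_rvP d (T : measurableType d) (f : T -> 'rV[R]_n) :
  (forall i, measurable_fun [set: T] (fun t => f t 0 i)) ->
  measurable_fun [set: T] f.
Proof.
move=> mf _ A mA; rewrite setTI; move: A mA.
apply: (@smallest_sub _ _ _ [set A | measurable (f @^-1` A)]).
  split => /=.
  - by rewrite preimage_set0.
  - by move=> A mA; rewrite setTD preimage_setC; exact: measurableC.
  - by move=> F mF; rewrite preimage_bigcup; exact: bigcupT_measurable.
rewrite -bigcup_seq; apply: bigcup_sub => i _ A [B mB <-] /=.
by rewrite setTI -comp_preimage -[X in measurable X]setTI; exact: mf.
Qed.

End measurable_row_vectors.

Section lebesgue_measure_rn.
Context (R : realType).

Definition cons_rv (n : nat) (p : R * 'rV[R]_n) : 'rV[R]_n.+1 :=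
  row_mx (p.1)%:M p.2.

Lemma measurable_cons_rv n : measurable_fun setT (@cons_rv n).
Proof.
apply: measurable_fun_rvP => i.
rewrite -[i](@splitK 1 n); case: (@fintype.split 1 n i) => j /=.
  rewrite (_ : (fun _ => _) = fst) //.
  apply/funext => p; apply: etrans (@row_mxEl R 1 1 n _ _ 0 j) _.
  by rewrite ord1 mxE eqxx mulr1n.
rewrite (_ : (fun _ => _) = (fun x : 'rV[R]_n => x 0 j) \o snd); last first.
  by apply/funext => p; exact: (@row_mxEr R 1 1 n).
by apply: measurableT_comp => //; exact: measurable_rv_coord.
Qed.

Definition uncons_rv (n : nat) (x : 'rV[R]_n.+1) : R * 'rV[R]_n :=
  (x 0 0, @rsubmx R 1 1 n x).

Lemma cons_rvK n : cancel (@cons_rv n) (@uncons_rv n).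
Proof.
move=> [r x]; rewrite /cons_rv /uncons_rv /= row_mxKr; congr pair.
have -> : (0 : 'I_n.+1) = lshift n (0 : 'I_1) by apply/val_inj.
apply: etrans (@row_mxEl R 1 1 n _ _ 0 0) _.
by rewrite mxE eqxx mulr1n.
Qed.

Lemma measurable_uncons_rv n : measurable_fun setT (@uncons_rv n).
Proof.
apply: measurable_fun_pair; first exact: measurable_rv_coord.
apply: measurable_fun_rvP => i.
rewrite (_ : (fun _ => _) = fun x : 'rV[R]_n.+1 => x 0 (rshift 1 i)).
  exact: measurable_rv_coord.
by apply/funext => x; rewrite mxE.
Qed.

Section step.
Context (n : nat) (mu : {sigma_finite_measure set 'rV[R]_n -> \bar R}).

Definition leb_step : set 'rV[R]_n.+1 -> \bar R :=
  pushforward (@lebesgue_measure R \x mu)%E (@cons_rv n).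

Let leb_step0 : leb_step set0 = 0%E.
Proof. by rewrite /leb_step /pushforward preimage_set0 measure0. Qed.

Let leb_step_ge0 A : (0 <= leb_step A)%E.
Proof. by rewrite /leb_step /pushforward; apply: measure_ge0. Qed.

Let leb_step_sigma_additive : semi_sigma_additive leb_step.
Proof.
exact: (measure_semi_sigma_additive
  (s := measure_function.measure_function_pushforward__canonical__measure_function_Measure
    (@product_measure1 _ _ (measurableTypeR R) 'rV[R]_n R
      (@lebesgue_measure R) mu) (@measurable_cons_rv n))).
Qed.

HB.instance Definition _ := isMeasure.Build _ _ _
  leb_step leb_step0 leb_step_ge0 leb_step_sigma_additive.

Let leb_step_sigma_finite : sigma_finite setT leb_step.
Proof.
have /sigma_finiteP[F [TF ndF Foo]] := sigma_finiteT (@lebesgue_measure R).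
have /sigma_finiteP[G [TG ndG Goo]] := sigma_finiteT mu.
exists (fun i => @uncons_rv n @^-1` (F i `*` G i)).
  rewrite -preimage_bigcup (_ : \bigcup_i (F i `*` G i) = setT) //.
  apply/seteqP; split => // -[x y] _.
  have [i _ Fix] : (\bigcup_i F i) x by rewrite -TF.
  have [j _ Gjy] : (\bigcup_i G i) y by rewrite -TG.
  exists (maxn i j) => //; split => /=.
    by move: x Fix; exact/subsetPset/ndF/leq_maxl.
  by move: y Gjy; exact/subsetPset/ndG/leq_maxr.
move=> i; have [mF Fi] := Foo i; have [mG Gi] := Goo i; split.
  rewrite -[X in measurable X]setTI; apply: measurable_uncons_rv => //.
  exact: measurableX.
rewrite /leb_step /pushforward -comp_preimage.
rewrite (_ : uncons_rv (n:=n) \o cons_rv (n:=n) = id); last first.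
  by apply/funext => p; exact: cons_rvK.
rewrite preimage_id product_measure1E// lte_mul_pinfty// ge0_fin_numE//.
Qed.

HB.instance Definition _ :=
  Measure_isSigmaFinite.Build _ _ _ leb_step leb_step_sigma_finite.

End step.

Fixpoint lebesgue_rv (n : nat) :
    {sigma_finite_measure set 'rV[R]_n -> \bar R} :=
  if n is m.+1 then leb_step (lebesgue_rv m) else \d_(0 : 'rV[R]_0).

End lebesgue_measure_rn.
Arguments lebesgue_rv {R} n.

(** * Euclidean geometry

The library norm on ['rV[R]_n] is the max-norm; it is only used below for its
topology. *)

Section euclidean.
Context (R : realType) (m : nat).
Implicit Types (x u v : 'rV[R]_m) (A D : set 'rV[R]_m) (f p : 'rV[R]_m -> R).

Definition dotp u v : R := (u *m v^T) 0 0.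

Definition enorm u : R := Num.sqrt (dotp u u).

Definition edist x A : R := inf [set enorm (x - y) | y in A].

Definition hyperplane (nu : 'rV[R]_m) (c : R) : set 'rV[R]_m :=
  [set x | dotp x nu = c].

Definition P1 D : set ('rV[R]_m -> R) :=
  [set p : 'rV[R]_m -> R | exists c g, forall x, D x -> p x = c + dotp g x].

Definition L2 D : set ('rV[R]_m -> R) :=
  [set f : 'rV[R]_m -> R | measurable_fun D f /\
    (\int[lebesgue_rv m]_(x in D) (f x ^+ 2)%:E < +oo)%E].

(** The trace at [x] of a function on [D]: its essential limit at [x] along
[D], so that it does not depend on the values on a null set, as is needed for
elements of L^2(D). *)
Definition trace D f x : R :=
  get [set l | forall e, 0 < e -> exists2 r, 0 < r &
    {ae lebesgue_rv m, forall y, D y -> ball x r y -> `|f y - l| < e}].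

End euclidean.

Definition grad (R : realType) (m : nat) (f : 'rV[R]_m.+1 -> R)
    (x : 'rV[R]_m.+1) : 'rV[R]_m.+1 :=
  \row_j 'D_(delta_mx 0 j) f x.

(** * Simplices and the Crouzeix-Raviart element

The dimension N >= 1 of the space is written [n.+1]; a simplex is given by its
N + 1 vertices [a i]. *)

Section crouzeix_raviart.
Context (R : realType) (n : nat) (a : 'I_n.+2 -> 'rV[R]_n.+1).

Definition nondegenerate : Prop :=
  (\matrix_(i < n.+1) (a (lift ord0 i) - a ord0)) \in unitmx.

Definition simplex : set 'rV[R]_n.+1 :=
  [set x | exists l : 'I_n.+2 -> R,
    [/\ forall i, 0 < l i, \sum_i l i = 1 & x = \sum_i l i *: a i]].

Definition ref_simplex : set 'rV[R]_n :=
  [set t | (forall k, 0 <= t 0 k) /\ \sum_k t 0 k <= 1].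

(** The face [F_i] is the one opposite to the vertex [a i]. It is the image of
[ref_simplex] by the affine map [face_param i], whose Jacobian
sqrt (det (E E^T)) is the square root of the Gram determinant of the edge
vectors; this gives the integral for the surface measure of [F_i]. *)
Definition face_edges (i : 'I_n.+2) : 'M[R]_(n, n.+1) :=
  \matrix_(k < n) (a (lift i (lift ord0 k)) - a (lift i ord0)).

Definition face_param (i : 'I_n.+2) (t : 'rV[R]_n) : 'rV[R]_n.+1 :=
  a (lift i ord0) + t *m face_edges i.

Definition face_integral (i : 'I_n.+2) (f : 'rV[R]_n.+1 -> R) : R :=
  Num.sqrt (\det (face_edges i *m (face_edges i)^T)) *
  \int[lebesgue_rv n]_(t in ref_simplex) f (face_param i t).

Definition face_measure (i : 'I_n.+2) : R := face_integral i (cst 1).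

(** [v] is a function on the open simplex, so [v|_{F_i}] is its trace. *)
Definition face_mean (i : 'I_n.+2) (v : 'rV[R]_n.+1 -> R) : R :=
  face_integral i (trace simplex v) / face_measure i.

(** As functions on [simplex], the two functions below are determined by these
conditions; their values elsewhere are irrelevant. *)
Definition CR_basis (i : 'I_n.+2) : 'rV[R]_n.+1 -> R :=
  get [set p | P1 simplex p /\ forall j, face_mean j p = (i == j)%:R].

Definition CR_interp (v : 'rV[R]_n.+1 -> R) : 'rV[R]_n.+1 -> R :=
  get [set p | P1 simplex p /\ forall j, face_mean j p = face_mean j v].

(** * The interface

The hyperplane is [hyperplane nu c], with [nu] the unit normal pointing from
[Tminus] to [Tplus]. *)

Context (nu : 'rV[R]_n.+1) (c : R).

Definition Gamma : set 'rV[R]_n.+1 := simplex `&` hyperplane nu c.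

Definition Tplus : set 'rV[R]_n.+1 := simplex `&` [set x | c < dotp x nu].

Definition Tminus : set 'rV[R]_n.+1 := simplex `&` [set x | dotp x nu < c].

Definition interface_element : Prop :=
  [/\ nondegenerate, enorm nu = 1, Gamma !=set0, Tplus !=set0 & Tminus !=set0].

Definition jump (v : 'rV[R]_n.+1 -> R) (x : 'rV[R]_n.+1) : R :=
  trace Tplus v x - trace Tminus v x.

Definition beta_T (bp bm : R) (x : 'rV[R]_n.+1) : R :=
  if x \in Tplus then bp else bm.

Definition S_h (bp bm : R) : set ('rV[R]_n.+1 -> R) :=
  [set phi | [/\ L2 simplex phi, P1 Tplus phi, P1 Tminus phi,
    forall x, Gamma x -> jump phi x = 0 &
    forall x, Gamma x ->
      jump (fun y => beta_T bp bm y * dotp (grad phi y) nu) x = 0]].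

Definition w_T (x : 'rV[R]_n.+1) : R :=
  if x \in Tplus then edist x (hyperplane nu c) else 0.

End crouzeix_raviart.

(* Main.v *)
Require Import Defs.
From mathcomp Require Import all_boot all_order all_algebra fingroup perm.
From mathcomp Require Import all_classical all_reals all_analysis.
From mathcomp Require Import measurable_realfun ring lra.

Set Implicit Arguments.
Unset Strict Implicit.
Unset Printing Implicit Defensive.

Import Order.TTheory GRing.Theory Num.Theory.
Import numFieldNormedType.Exports.

Local Open Scope classical_set_scope.
Local Open Scope ring_scope.

(** On a simplex T cut by the hyperplane [nu . x = c], let W be the positive part of
[nu . x - c], which is the function w of the statement. A function that is affine
on either side of the interface and continuous across it is [p + k W] almost
everywhere, with [p] affine and [k] a number ([affine_zero_on_Gamma]), and the
flux condition is [beta+ (grad p . nu + k) = beta- grad p . nu]. If moreover its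
face means are those of the Crouzeix-Raviart basis function [lambda_i], then
[p = lambda_i - k Pi W], because an affine function is determined by its face means
([vertex_values_of_means]). So only [k] is unknown, and it solves the linear
equation

  [k (beta+ + (beta- - beta+) theta) = (beta- - beta+) grad lambda_i . nu],
  where [theta = grad (Pi W) . nu].

Everything rests on the identity [theta = |T+| / |T|] ([interp_pos_slope]): it puts
[theta] in [[0, 1]], so that the coefficient of [k] is a convex combination of
[beta+] and [beta-], hence positive, and it turns the solution into the announced
formula.

The identity is the divergence theorem: [|T| grad (Pi W)] is the sum of the
integrals of [W n] over the faces, with [n] the outer normal, which is the integral
of [grad W] over T, which is [|T+| nu]. In barycentric coordinates it reads
([simplex_divergence], [face_mean_pos_affineB])

  [N (mean of W over F_i - mean of W over F_j) = (l(a_j) - l(a_i)) |T+| / |T|],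

where [N] is the dimension, [l = nu . x - c] and the [a_i] are the vertices. It is
obtained by integrating the derivative of W along the segments parallel to the
edge from [a_i] to [a_j]. For the affine functions that are nonnegative on T the
same formula gives their face means, so that no volume of a simplex is needed. The
passage from T to a reference simplex, and the permutation of vertices that
reduces any edge to a fixed one, are affine changes of variables. They are needed
up to a constant factor only, and in that form they follow from the invariance of
Lebesgue measure under translations and central symmetries
([affine_change_of_variables]).

Traces enter through two facts: the trace of a function that is almost everywhere
equal to a continuous one is the value of the latter, wherever the domain has
positive measure in every ball ([trace_continuous]); and this holds at the points
of the faces of T, as well as at those of the interface seen from either side. *)

(** * Lebesgue measure of affine images *)

Lemma lebesgue_rvSE (R : realType) n (A : set 'rV[R]_n.+1) :
  lebesgue_rv n.+1 A =
  (@lebesgue_measure R \x lebesgue_rv n)%E (@cons_rv R n @^-1` A).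
Proof. by []. Qed.

Lemma lebesgue_measure_isometry (R : realType) (e v : R) (A : set R) :
  e = 1 \/ e = -1 -> measurable A ->
  lebesgue_measure ((fun x : measurableTypeR R => e * x + v : measurableTypeR R) @^-1` A)
  = lebesgue_measure A.
Proof.
move=> he mA.
have mf : measurable_fun setT (fun x : measurableTypeR R => e * x + v : measurableTypeR R).
  apply: measurable_funD => //; apply: measurable_funM => //.
suff -> : lebesgue_measure A = pushforward lebesgue_measure
   (fun x : measurableTypeR R => e * x + v : measurableTypeR R) A by [].
pose m' :=
  measure_function.measure_function_pushforward__canonical__measure_function_Measure
    (@lebesgue_measure R) mf.
apply: (@lebesgue_measure_unique R m' _ A mA) => _ [[a b]] _ <-.
rewrite /m' /= /pushforward.
case: he => ->.
  rewrite (_ : _ @^-1` _ = `]a - v, b - v]%classic).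
    rewrite !lebesgue_measure_itv/= !lte_fin ltrD2r; case: ifP => // _.
    by rewrite -!EFinD; congr EFin; ring.
  by apply/seteqP; split => x /=; rewrite !in_itv /= mul1r ltrBlDr lerBrDr.
rewrite (_ : _ @^-1` _ = `[v - b, v - a[%classic).
  rewrite !lebesgue_measure_itv/= !lte_fin ltrD2l ltrN2; case: ifP => // _.
  by rewrite -!EFinD; congr EFin; ring.
apply/seteqP; split => x /=; rewrite !in_itv /= => /andP[]; lra.
Qed.

Lemma cons_rv0 (R : realType) n (p : R * 'rV[R]_n) : cons_rv p 0 0 = p.1.
Proof. by have /(congr1 fst) := cons_rvK p. Qed.

Lemma cons_rvS (R : realType) n (p : R * 'rV[R]_n) i :
  cons_rv p 0 (lift ord0 i) = p.2 0 i.
Proof.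
rewrite (_ : lift ord0 i = rshift 1 i); last exact/val_inj.
exact: (@row_mxEr R 1 1 n).
Qed.

Lemma cons_rv_affine (R : realType) n (e : R) (v : 'rV[R]_n.+1) (p : R * 'rV[R]_n) :
  e *: cons_rv p + v =
  cons_rv (e * p.1 + v 0 0, e *: p.2 + \row_i v 0 (lift ord0 i)).
Proof.
apply/rowP => i; rewrite [LHS]mxE [X in X + _]mxE; case: (unliftP ord0 i) => [j ->|->].
  by rewrite !cons_rvS !mxE.
by rewrite !cons_rv0.
Qed.

Lemma measurable_affine_rv (R : realType) n (e : R) (v : 'rV[R]_n) :
  measurable_fun setT (fun x : 'rV[R]_n => e *: x + v).
Proof.
apply: measurable_fun_rvP => i; rewrite (_ : (fun _ => _) = (fun x : 'rV[R]_n => e * x 0 i + v 0 i)).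
  apply: measurable_funD => //; apply: measurable_funM => //; exact: measurable_rv_coord.
by apply/funext => x; rewrite !mxE.
Qed.

(** Two sigma-finite measures on a product that agree on boxes are equal, so the
one-dimensional case propagates coordinate by coordinate. Only the linear parts
1 and -1 are covered: these are what the Fubini argument of
[affine_change_of_variables] uses. *)
Lemma lebesgue_rv_isometry (R : realType) n (e : R) (v : 'rV[R]_n) (A : set 'rV[R]_n) :
  e = 1 \/ e = -1 -> measurable A ->
  lebesgue_rv n ((fun x => e *: x + v) @^-1` A) = lebesgue_rv n A.
Proof.
move=> he; elim: n v A => [|n IH] v A mA.
  by congr (lebesgue_rv 0 _); apply/seteqP; split => x /=; rewrite (thinmx0 (_ + _)) (thinmx0 x).
pose v' := \row_i v 0 (lift ord0 i).
have mf1 : measurable_fun setT (fun x : measurableTypeR R => e * x + v 0 0 : measurableTypeR R).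
  by apply: measurable_funD => //; apply: measurable_funM.
have mf2 : measurable_fun setT (fun x : 'rV[R]_n => e *: x + v') by exact: measurable_affine_rv.
pose f (p : measurableTypeR R * 'rV[R]_n) : measurableTypeR R * 'rV[R]_n :=
  (e * p.1 + v 0 0, e *: p.2 + v').
have mf : measurable_fun setT f.
  apply: measurable_fun_pair.
    exact: (measurableT_comp mf1 measurable_fst).
  exact: (measurableT_comp mf2 measurable_snd).
rewrite !lebesgue_rvSE.
have mcA : measurable (@cons_rv R n @^-1` A).
  by rewrite -[X in measurable X]setTI; exact: measurable_cons_rv.
pose m' :=
  measure_function.measure_function_pushforward__canonical__measure_function_Measure
    (@lebesgue_measure R \x lebesgue_rv n)%E mf.
transitivity (m' (@cons_rv R n @^-1` A)).
  rewrite /m' /= /pushforward; congr ((_ \x _)%E _).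
  by apply/seteqP; split => p /=; rewrite cons_rv_affine.
apply/esym/product_measure_unique => // B C mB mC.
rewrite /m' /= /pushforward.
transitivity ((@lebesgue_measure R \x lebesgue_rv n)%E
    (((fun x => e * x + v 0 0) @^-1` B) `*` ((fun x => e *: x + v') @^-1` C))).
  by [].
rewrite product_measure1E //; last 2 first.
  - by rewrite -[X in measurable X]setTI; exact: mf1.
  - by rewrite -[X in measurable X]setTI; exact: mf2.
by congr (_ * _)%E; [exact: lebesgue_measure_isometry | exact: IH].
Qed.

Lemma ge0_integral_isometry (R : realType) n (e : R) (v : 'rV[R]_n) (f : 'rV[R]_n -> \bar R) :
  e = 1 \/ e = -1 -> measurable_fun setT f -> (forall x, 0 <= f x)%E ->
  (\int[lebesgue_rv n]_x f (e *: x + v)%R = \int[lebesgue_rv n]_x f x)%E.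
Proof.
move=> he mf f0.
rewrite -(@ge0_integral_pushforward _ _ _ _ R _ (measurable_affine_rv e v) (lebesgue_rv n) setT f) //.
apply: eq_measure_integral => [|m' A mA _]; first exact: measurable_affine_rv.
rewrite /= /pushforward; exact: lebesgue_rv_isometry.
Qed.

(** The cross-multiplied form avoids the Jacobian: it says that the integral of
[f \o Phi] is a constant multiple of that of [f], the constant being the same for
all [f]. For an affine [Phi] with an onto linear part, a right inverse of that
part serves as [Psi]. Both sides are the double integral of [f (Phi x) * g (y + Phi x)]: one moves
[y] by [Phi x] in one direction, and [x] by [Psi (- y)] followed by the
reflection of [y] in the other. *)
Lemma affine_change_of_variables (R : realType) n (Phi Psi : 'rV[R]_n -> 'rV[R]_n)
    (f g : 'rV[R]_n -> \bar R) :
  measurable_fun setT Phi -> (forall x y, Phi (x + Psi y) = Phi x + y) ->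
  measurable_fun setT f -> (forall x, 0 <= f x)%E ->
  measurable_fun setT g -> (forall x, 0 <= g x)%E ->
  ((\int[lebesgue_rv n]_x f (Phi x)) * (\int[lebesgue_rv n]_x g x) =
   (\int[lebesgue_rv n]_x g (Phi x)) * (\int[lebesgue_rv n]_x f x))%E.
Proof.
move=> mPhi PhiD mf f0 mg g0.
have mfP := measurableT_comp mf mPhi.
have mgP := measurableT_comp mg mPhi.
have If0 : (0 <= \int[lebesgue_rv n]_x f x)%E by exact: integral_ge0.
have Ig0 : (0 <= \int[lebesgue_rv n]_x g x)%E by exact: integral_ge0.
transitivity (\int[lebesgue_rv n]_x \int[lebesgue_rv n]_y (f (Phi x) * g (y + Phi x)%R))%E.
  rewrite -(@ge0_integralZr _ _ _ (lebesgue_rv n) _ measurableT (f \o Phi)) //; last first.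
    by move=> x _ /=; exact: f0.
  apply: eq_integral => x _; rewrite -(@ge0_integral_isometry _ _ 1 (Phi x) g) //; last by left.
  rewrite -ge0_integralZl//=; first by under eq_integral do rewrite scale1r.
  by apply: measurableT_comp => //; exact: measurable_affine_rv.
have mxy (b : R) : measurable_fun setT (fun p : 'rV[R]_n * 'rV[R]_n => b *: p.2 + Phi p.1).
  apply: measurable_fun_rvP => i.
  rewrite (_ : (fun _ => _) = (fun p : 'rV[R]_n * 'rV[R]_n => b * p.2 0 i + Phi p.1 0 i)); last first.
    by apply/funext => p; rewrite !mxE.
  apply: measurable_funD.
    apply: measurable_funM => //.
    exact: (measurableT_comp (measurable_rv_coord i) measurable_snd).
  apply: (measurableT_comp (measurable_rv_coord i)).
  exact: (measurableT_comp mPhi measurable_fst).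
pose F1 (p : 'rV[R]_n * 'rV[R]_n) := (f (Phi p.1) * g (p.2 + Phi p.1)%R)%E.
rewrite [X in X = _](_ : _ = \int[lebesgue_rv n]_x \int[lebesgue_rv n]_y F1 (x, y))%E //.
rewrite fubini_tonelli; last 2 first.
- apply: emeasurable_funM; first exact: (measurableT_comp mfP measurable_fst).
  apply: (measurableT_comp mg); have := mxy 1.
  by under eq_fun do rewrite scale1r.
- by move=> p; exact: mule_ge0.
transitivity (\int[lebesgue_rv n]_y \int[lebesgue_rv n]_x (f (-1 *: y + Phi x)%R * g (Phi x)))%E.
  apply: eq_integral => y _.
  rewrite -(@ge0_integral_isometry _ _ 1 (Psi (- y))
      (fun x => f (Phi x) * g (y + Phi x)%R)%E) //; last 3 first.
  - by left.
  - apply: emeasurable_funM => //; apply: (measurableT_comp mg).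
    apply: (measurableT_comp _ mPhi); have := measurable_affine_rv 1 y.
    by under eq_fun do rewrite scale1r addrC.
  - by move=> x; exact: mule_ge0.
  by apply: eq_integral => x _; rewrite scale1r PhiD scaleN1r addrCA subrr addr0 addrC.
pose F2 (p : 'rV[R]_n * 'rV[R]_n) := (f (-1 *: p.2 + Phi p.1)%R * g (Phi p.1))%E.
rewrite [X in X = _](_ : _ = \int[lebesgue_rv n]_y \int[lebesgue_rv n]_x F2 (x, y))%E //.
rewrite -fubini_tonelli; last 2 first.
- apply: emeasurable_funM; last exact: (measurableT_comp mgP measurable_fst).
  exact: (measurableT_comp mf (mxy (-1))).
- by move=> p; exact: mule_ge0.
rewrite -(@ge0_integralZr _ _ _ (lebesgue_rv n) _ measurableT (g \o Phi)) //; last first.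
  by move=> x _ /=; exact: g0.
apply: eq_integral => x _ /=; rewrite -(@ge0_integral_isometry _ _ (-1) (Phi x) f) //; last by right.
rewrite -ge0_integralZl//=; first by apply: eq_integral => y _; exact: muleC.
by apply: measurableT_comp => //; exact: measurable_affine_rv.
Qed.

Lemma lebesgue_rv_affine_preimage (R : realType) n (Phi Psi : 'rV[R]_n -> 'rV[R]_n)
    (A B : set 'rV[R]_n) :
  measurable_fun setT Phi -> (forall x y, Phi (x + Psi y) = Phi x + y) ->
  measurable A -> measurable B ->
  (lebesgue_rv n (Phi @^-1` A) * lebesgue_rv n B =
   lebesgue_rv n (Phi @^-1` B) * lebesgue_rv n A)%E.
Proof.
move=> mPhi PhiD mA mB.
have mP C : measurable C -> measurable (Phi @^-1` C).
  by move=> mC; rewrite -[X in measurable X]setTI; exact: mPhi.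
have := @affine_change_of_variables R n Phi Psi (EFin \o \1_A) (EFin \o \1_B) mPhi PhiD.
have E C : measurable C ->
    (\int[lebesgue_rv n]_x (EFin \o \1_C) (Phi x) = lebesgue_rv n (Phi @^-1` C))%E.
  move=> mC; rewrite -[X in lebesgue_rv n X]setIT -integral_indic //; last exact: mP.
have E' C : measurable C ->
    (\int[lebesgue_rv n]_x (EFin \o \1_C) x = lebesgue_rv n C)%E.
  by move=> mC; rewrite integral_indic // setIT.
rewrite !E // !E' //; apply => //.
- by apply/measurable_EFinP; exact: measurable_indic.
- by move=> x; rewrite lee_fin.
- by apply/measurable_EFinP; exact: measurable_indic.
- by move=> x; rewrite lee_fin.
Qed.

(** * Balls and hyperplanes *)

Lemma measurable_forall d (T : measurableType d) (I : finType) (P : I -> T -> Prop) :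
  (forall i, measurable [set x | P i x]) -> measurable [set x | forall i, P i x].
Proof.
move=> mP; rewrite (_ : [set _ | _] = \bigcap_(i in [set: I]) [set x | P i x]).
  by apply: fin_bigcap_measurable => //; exact: finite_finset.
by apply/seteqP; split => x /= h => [i _|i]; exact: h.
Qed.

Lemma measurable_ball_rv (R : realType) n (x : 'rV[R]_n) (e : R) :
  0 < e -> measurable (ball x e).
Proof.
move=> e0; rewrite (_ : ball x e = [set y | forall i, ball (x 0 i) e (y 0 i)]).
  apply: measurable_forall => i.
  rewrite (_ : [set _ | _] = (fun y : 'rV[R]_n => y 0 i) @^-1` (ball (x 0 i) e)) //.
  rewrite -[X in measurable X]setTI; apply: (measurable_rv_coord i) => //.
  exact: measurable_ball.
apply/seteqP; split => y /=; first by case=> _ h i; exact: h.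
by move=> h; split => // i j; rewrite ord1.
Qed.

Lemma lebesgue_rv_ball (R : realType) n (x : 'rV[R]_n) (e : R) :
  0 < e -> lebesgue_rv n (ball x e) = (((e *+ 2) ^+ n)%:E).
Proof.
move=> e0; elim: n x => [|n IH] x.
  by rewrite expr0 /= /dirac indicE mem_set //=; split => // i [].
rewrite lebesgue_rvSE.
rewrite (_ : _ @^-1` _ = ball (x 0 0) e `*` ball (\row_i x 0 (lift ord0 i)) e).
  rewrite product_measure1E //; last 2 first.
  - exact: measurable_ball.
  - exact: measurable_ball_rv.
  rewrite IH [X in (X * _)%E](_ : _ = (e *+ 2)%:E); first by rewrite -EFinM exprS.
  by apply: lebesgue_measure_ball; exact: ltW.
apply/seteqP; split => p /=.
  case=> _ h; split; first by have := h 0 0; rewrite cons_rv0.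
  by split => // i j; rewrite ord1 mxE -cons_rvS.
case=> h0 [_ h]; split => // i j; rewrite ord1; case: (unliftP ord0 j) => [k ->|->].
  by rewrite cons_rvS; have := h 0 k; rewrite mxE.
by have -> : ord0 = 0 :> 'I_n.+1 by []; rewrite cons_rv0.
Qed.

Lemma dotpE (R : realType) n (u v : 'rV[R]_n) : dotp u v = \sum_k u 0 k * v 0 k.
Proof. by rewrite /dotp mxE; apply: eq_bigr => k _; rewrite mxE. Qed.

Lemma measurable_dotp (R : realType) n (g : 'rV[R]_n) :
  measurable_fun setT (fun x => dotp x g).
Proof.
rewrite (_ : (fun _ => _) = (fun x : 'rV[R]_n => \sum_k x 0 k * g 0 k)).
  apply: measurable_sum => k; apply: measurable_funM => //; exact: measurable_rv_coord.
by apply/funext => x; rewrite dotpE.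
Qed.

Lemma measurable_hyperplane (R : realType) n (g : 'rV[R]_n) (c : R) :
  measurable (hyperplane g c).
Proof.
rewrite (_ : hyperplane g c = (fun x => dotp x g) @^-1` [set c]) //.
by rewrite -[X in measurable X]setTI; exact: measurable_dotp.
Qed.

(** If the first component of the normal vanishes, the hyperplane is a product of
the line with a hyperplane of one dimension less; otherwise every section
parallel to the first axis is a point. *)
Lemma lebesgue_rv_hyperplane (R : realType) n (g : 'rV[R]_n) (c : R) :
  g != 0 -> lebesgue_rv n (hyperplane g c) = 0%E.
Proof.
elim: n g c => [|n IH] g c g0; first by rewrite (thinmx0 g) eqxx in g0.
rewrite lebesgue_rvSE.
pose g' := \row_i g 0 (lift ord0 i).
have mH : measurable (@cons_rv R n @^-1` hyperplane g c).
  by rewrite -[X in measurable X]setTI; apply: measurable_cons_rv => //; exact: measurable_hyperplane.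
have E p : dotp (cons_rv p) g = p.1 * g 0 0 + dotp p.2 g'.
  rewrite dotpE big_ord_recl cons_rv0 dotpE; congr (_ + _).
  by apply: eq_bigr => i _; rewrite cons_rvS mxE.
have [g00|g00] := eqVneq (g 0 0) 0.
  rewrite (_ : _ @^-1` _ = setT `*` hyperplane g' c).
    rewrite product_measure1E //; last exact: measurable_hyperplane.
    rewrite IH ?mule0 //; apply: contra_neq g0 => /rowP g'0.
    apply/rowP => i; rewrite mxE; case: (unliftP ord0 i) => [j ->|-> //].
    by have := g'0 j; rewrite !mxE.
  by apply/seteqP; split => p /=; rewrite /hyperplane /= E g00 mulr0 add0r => // -[].
rewrite (@product_measure_unique _ _ _ _ R _ _ (lebesgue_measure \x^ lebesgue_rv n)%E) //; last first.
  by move=> A B mA mB; exact: product_measure2E.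
apply: integral0_eq => y _ /=.
rewrite (_ : ysection _ _ = [set (c - dotp y g') / g 0 0]); first exact: lebesgue_measure_set1.
apply/seteqP; split => s; rewrite /ysection /= inE /hyperplane /= E /=.
  by move=> <-; field.
by move=> ->; field.
Qed.

(** * Barycentric coordinates on the reference simplex *)

Lemma measurable_pos_preimage d (T : measurableType d) (R : realType) (f : T -> R) :
  measurable_fun setT f -> measurable [set x | 0 < f x].
Proof.
move=> mf; rewrite (_ : [set _ | _] = f @^-1` `]0, +oo[%classic).
  by rewrite -[X in measurable X]setTI; apply: mf.
by apply/seteqP; split => x /=; rewrite in_itv /= andbT.
Qed.

Lemma measurable_nneg_preimage d (T : measurableType d) (R : realType) (f : T -> R) :
  measurable_fun setT f -> measurable [set x | 0 <= f x].
Proof.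
move=> mf; rewrite (_ : [set _ | _] = f @^-1` `[0, +oo[%classic).
  by rewrite -[X in measurable X]setTI; apply: mf.
by apply/seteqP; split => x /=; rewrite in_itv /= andbT.
Qed.

Section barycentric.
Context (R : realType) (m : nat).
Implicit Types (x y : 'rV[R]_m) (k : 'I_m.+1) (b : 'I_m.+1 -> R).

(** Barycentric coordinates of [x] in the simplex whose vertices are the origin,
labelled [ord0], and the unit vectors. *)
Definition bary x k : R :=
  oapp (fun j => x 0 j) (1 - \sum_j x 0 j) (unlift ord0 k).

(** Every affine function is of this form, [b] being its values at the vertices.
Integrals over faces and measures of cut simplices thus depend on vertex values
only. *)
Definition bary_comb b x : R := \sum_k b k * bary x k.

Definition std_simplex : set 'rV[R]_m := [set x | forall k, 0 < bary x k].

Lemma bary0 x : bary x ord0 = 1 - \sum_j x 0 j.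
Proof. by rewrite /bary unlift_none. Qed.

Lemma baryS x j : bary x (lift ord0 j) = x 0 j.
Proof. by rewrite /bary liftK. Qed.

Lemma sum_bary x : \sum_k bary x k = 1.
Proof.
rewrite big_ord_recl bary0; under [X in _ + X]eq_bigr do rewrite baryS.
by rewrite subrK.
Qed.

Lemma bary_addB x u w k : bary (x + u - w) k = bary x k + bary u k - bary w k.
Proof.
case: (unliftP ord0 k) => [j ->|->]; first by rewrite !baryS !mxE.
rewrite !bary0; under eq_bigr do rewrite !mxE.
by rewrite sumrB big_split /=; ring.
Qed.

Lemma ref_simplexE : @ref_simplex R m = [set x | forall k, 0 <= bary x k].
Proof.
apply/seteqP; split => x /=.
  case=> x0 x1 k; case: (unliftP ord0 k) => [j ->|->]; first by rewrite baryS.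
  by rewrite bary0 subr_ge0.
move=> h; split=> [j|]; first by have := h (lift ord0 j); rewrite baryS.
by have := h ord0; rewrite bary0 subr_ge0.
Qed.

Lemma bary_le1 x k : (forall j, 0 <= bary x j) -> bary x k <= 1.
Proof.
move=> h; rewrite -(sum_bary x) (bigD1 k) //= lerDl.
by apply: sumr_ge0 => j _; exact: h.
Qed.

Lemma measurable_bary k : measurable_fun setT (fun x => bary x k).
Proof.
case: (unliftP ord0 k) => [j ->|->].
  by under eq_fun do rewrite baryS; exact: measurable_rv_coord.
under eq_fun do rewrite bary0.
apply: measurable_funB => //; apply: measurable_sum => j.
exact: measurable_rv_coord.
Qed.

Lemma measurable_bary_comb b : measurable_fun setT (bary_comb b).
Proof.
apply: measurable_sum => k; apply: measurable_funM => //; exact: measurable_bary.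
Qed.

Lemma measurable_pos_bary_comb b : measurable_fun setT (fun x => Num.max 0 (bary_comb b x)).
Proof. by apply: measurable_maxr => //; exact: measurable_bary_comb. Qed.

Lemma measurable_ref_simplex : measurable (@ref_simplex R m).
Proof.
rewrite ref_simplexE; apply: measurable_forall => k.
by apply: measurable_nneg_preimage; exact: measurable_bary.
Qed.

Lemma measurable_std_simplex : measurable std_simplex.
Proof.
by apply: measurable_forall => k; apply: measurable_pos_preimage; exact: measurable_bary.
Qed.

Lemma std_simplex_sub : std_simplex `<=` @ref_simplex R m.
Proof. by move=> x h; rewrite ref_simplexE => k; exact/ltW. Qed.

Lemma ref_simplex_lty : (lebesgue_rv m (@ref_simplex R m) < +oo)%E.
Proof.
apply: (@le_lt_trans _ _ (lebesgue_rv m (ball (0 : 'rV[R]_m) 2))); last first.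
  by rewrite lebesgue_rv_ball // ltry.
apply: le_measure; rewrite ?inE.
- exact: measurable_ref_simplex.
- exact: measurable_ball_rv.
move=> x; rewrite ref_simplexE => h; split => // i j; rewrite ord1 mxE.
rewrite -ball_normE /= sub0r normrN -baryS ger0_norm //.
by apply: le_lt_trans (bary_le1 _ h) _; rewrite ltr1n.
Qed.

(** A ball around the point with all barycentric coordinates 1 / (m + 1) lies in
the simplex. *)
Lemma std_simplex_gt0 : (0 < lebesgue_rv m std_simplex)%E.
Proof.
pose d : R := m.+1%:R^-1; pose e := d / m.+1%:R.
have d0 : 0 < d by rewrite invr_gt0.
have e0 : 0 < e by rewrite divr_gt0.
have ed : e <= d by rewrite ler_pdivrMr // ler_peMr ?ler1n // ltW.
apply: (@lt_le_trans _ _ (lebesgue_rv m (ball (\row_j d) e))).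
  by rewrite lebesgue_rv_ball // lte_fin exprn_gt0 // mulrn_wgt0.
apply: le_measure; rewrite ?inE.
- exact: measurable_ball_rv.
- exact: measurable_std_simplex.
move=> x [_ h].
have {}h j : 0 < x 0 j < d + e.
  have := h 0 j; rewrite mxE -ball_normE /= ltr_distlC => /andP[h1 ->].
  by rewrite andbT (le_lt_trans _ h1) // subr_ge0.
move=> k; case: (unliftP ord0 k) => [j ->|->].
  by rewrite baryS; have /andP[] := h j.
rewrite bary0 subr_gt0.
have md : m.+1%:R * d = 1 by rewrite divff.
have me : m.+1%:R * e = d by rewrite /e mulrC divfK.
have : \sum_j x 0 j <= m%:R * (d + e).
  rewrite -[m in m%:R](card_ord m) mulr_natl -sumr_const.
  by apply: ler_sum => j _; have /andP[_ /ltW] := h j.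
move=> /le_lt_trans; apply.
move: md me; rewrite -natr1; nra.
Qed.

Lemma ref_simplex_gt0 : (0 < lebesgue_rv m (@ref_simplex R m))%E.
Proof.
apply: (lt_le_trans std_simplex_gt0).
apply: le_measure; rewrite ?inE.
- exact: measurable_std_simplex.
- exact: measurable_ref_simplex.
- exact: std_simplex_sub.
Qed.

Lemma std_simplex_lty : (lebesgue_rv m std_simplex < +oo)%E.
Proof.
apply: (le_lt_trans _ ref_simplex_lty).
apply: le_measure; rewrite ?inE.
- exact: measurable_std_simplex.
- exact: measurable_ref_simplex.
- exact: std_simplex_sub.
Qed.

End barycentric.

(** * Permuting the vertices of the reference simplex *)

Lemma mule_cancel (R : realType) (v a b : \bar R) :
  (0 < v)%E -> (v < +oo)%E -> (a * v = v * b)%E -> a = b.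
Proof.
case: v => // r; rewrite lte_fin => r0 _.
rewrite [RHS]muleC => /(congr1 (fun z => z * (r^-1)%:E)%E).
by rewrite -!muleA -EFinM mulfV ?gt_eqF // !mule1.
Qed.

Section permutation.
Context (R : realType) (m : nat).
Implicit Types (x y : 'rV[R]_m) (s : {perm 'I_m.+1}).

Definition perm_bary s x : 'rV[R]_m := \row_j bary x (s (lift ord0 j)).

Lemma bary_perm s x k : bary (perm_bary s x) k = bary x (s k).
Proof.
case: (unliftP ord0 k) => [j ->|->]; first by rewrite baryS mxE.
rewrite bary0 -(sum_bary x) (reindex_inj (@perm_inj _ s)) big_ord_recl.
by under [X in _ - X]eq_bigr do rewrite mxE; rewrite addrK.
Qed.

Lemma forall_bary_perm s x (P : R -> Prop) :
  (forall k, P (bary (perm_bary s x) k)) <-> forall k, P (bary x k).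
Proof.
split=> h k; last by rewrite bary_perm.
by have := h ((s^-1)%g k); rewrite bary_perm permKV.
Qed.

Lemma mem_ref_simplex_perm s x :
  (perm_bary s x \in @ref_simplex R m) = (x \in @ref_simplex R m).
Proof.
rewrite ref_simplexE; apply/idP/idP => /set_mem h; apply: mem_set.
  exact: (forall_bary_perm s x (fun r => 0 <= r)).1 h.
exact: (forall_bary_perm s x (fun r => 0 <= r)).2 h.
Qed.

(** A permutation of the vertices is an affine map that preserves the simplex;
taking for [g] the indicator of the simplex in [affine_change_of_variables]
shows that its Jacobian is 1. *)
Lemma ge0_integral_perm_bary s (f : 'rV[R]_m -> \bar R) :
  measurable_fun setT f -> (forall x, 0 <= f x)%E ->
  (\int[lebesgue_rv m]_x f (perm_bary s x) = \int[lebesgue_rv m]_x f x)%E.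
Proof.
move=> mf f0.
have mP : measurable_fun setT (perm_bary s).
  apply: measurable_fun_rvP => j; under eq_fun do rewrite mxE.
  exact: measurable_bary.
pose g : 'rV[R]_m -> \bar R := EFin \o \1_(@ref_simplex R m).
have mg : measurable_fun setT g.
  by apply/measurable_EFinP/measurable_indic; exact: measurable_ref_simplex.
have g0 x : (0 <= g x)%E by rewrite lee_fin.
pose Psi y := perm_bary (s^-1)%g y - perm_bary (s^-1)%g 0.
have PhiD x y : perm_bary s (x + Psi y) = perm_bary s x + y.
  apply/rowP => j; rewrite !mxE /Psi addrA bary_addB !bary_perm permK !baryS.
  by rewrite mxE subr0.
have := affine_change_of_variables mP PhiD mf f0 mg g0.
have -> : (\int[lebesgue_rv m]_x g (perm_bary s x) = \int[lebesgue_rv m]_x g x)%E.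
  apply: eq_integral => x _; rewrite /g /= !indicE; congr ((_ _)%:R%:E).
  exact: mem_ref_simplex_perm.
rewrite integral_indic ?setIT //; last exact: measurable_ref_simplex.
by apply: mule_cancel; [exact: ref_simplex_gt0 | exact: ref_simplex_lty].
Qed.

Lemma integral_ref_simplex_perm s (F : 'rV[R]_m -> R) :
  measurable_fun setT F -> (forall x, 0 <= F x) ->
  \int[lebesgue_rv m]_(x in @ref_simplex R m) F (perm_bary s x) =
  \int[lebesgue_rv m]_(x in @ref_simplex R m) F x.
Proof.
move=> mF F0; rewrite /Rintegral; congr fine.
rewrite integral_mkcond [RHS]integral_mkcond.
rewrite -[RHS](@ge0_integral_perm_bary s (_ \_ _)).
- apply: eq_integral => x _; rewrite /patch; congr (if _ then _ else _).
  by rewrite mem_ref_simplex_perm.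
- apply/(measurable_restrictT _ _).1; first exact: measurable_ref_simplex.
  by apply/measurable_EFinP; exact: measurable_funTS.
- by move=> x; rewrite /patch; case: ifP => // _; rewrite lee_fin.
Qed.

Lemma bary_comb_perm s (b : 'I_m.+1 -> R) x :
  bary_comb b (perm_bary s x) = bary_comb (b \o (s^-1)%g) x.
Proof.
rewrite /bary_comb [RHS](reindex_inj (@perm_inj _ s)) /=; apply: eq_bigr => k _.
by rewrite permK bary_perm.
Qed.

Lemma lebesgue_rv_perm_bary s (b : 'I_m.+1 -> R) :
  lebesgue_rv m (@std_simplex R m `&` [set x | 0 < bary_comb (b \o s) x]) =
  lebesgue_rv m (@std_simplex R m `&` [set x | 0 < bary_comb b x]).
Proof.
have mS (c : 'I_m.+1 -> R) : measurable (@std_simplex R m `&` [set x | 0 < bary_comb c x]).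
  apply: measurableI; first exact: measurable_std_simplex.
  apply: measurable_pos_preimage; exact: measurable_bary_comb.
have E (A : set 'rV[R]_m) : measurable A ->
    lebesgue_rv m A = (\int[lebesgue_rv m]_x (\1_A x)%:E)%E.
  by move=> mA; rewrite integral_indic // setIT.
have bK : (b \o s) \o (s^-1)%g = b by apply/funext => k /=; rewrite permKV.
rewrite [LHS]E // [RHS]E // -[LHS](@ge0_integral_perm_bary s) /=.
- apply: eq_integral => x _; rewrite !indicE; congr ((_ _)%:R%:E).
  apply/idP/idP => /set_mem /= [h1 h2]; apply: mem_set; split.
  + exact: (forall_bary_perm s x (fun r => 0 < r)).1 h1.
  + by move: h2; rewrite bary_comb_perm bK.
  + exact: (forall_bary_perm s x (fun r => 0 < r)).2 h1.
  + by rewrite /= bary_comb_perm bK.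
- by apply/measurable_EFinP; exact: measurable_indic.
- by move=> x; rewrite lee_fin.
Qed.

End permutation.

(** * The divergence theorem on the reference simplex *)

(** This is the fundamental theorem of calculus for the positive part of the
affine function [s |-> h + s * d]: its derivative is [d] where it is positive.
The integral of that derivative is [d] times the length [L]. *)
Lemma lebesgue_segment_pos (R : realType) (r h d : R) : 0 <= r ->
  exists L : R, [/\ lebesgue_measure [set s : R | [/\ 0 < s, s < r & 0 < h + s * d]] = L%:E,
    0 <= L <= r & d * L = Num.max 0 (h + r * d) - Num.max 0 h].
Proof.
move=> r0.
have itvE (u v : R) : lebesgue_measure (`]u, v[%classic : set R) = (Num.max 0 (v - u))%:E.
  rewrite lebesgue_measure_itv /= lte_fin; case: ltP => uv.
    by rewrite -EFinB; congr EFin; apply/esym/max_idPr; rewrite subr_ge0 ltW.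
  by congr EFin; apply/esym/max_idPl; rewrite subr_le0.
have [d0|d0|->] := ltgtP d 0; last first.
- have E L : 0 * L = Num.max 0 (h + r * 0) - Num.max 0 h by rewrite mulr0 addr0 subrr mul0r.
  have [h0|] := boolP (0 < h).
    exists r; split; [|by rewrite r0 lexx|exact: E].
    rewrite (_ : mkset _ = `]0, r[%classic); first by rewrite itvE subr0; congr EFin; exact/max_idPr.
    by apply/seteqP; split => s /=; rewrite in_itv /= mulr0 addr0; [case=> -> ->|case/andP].
  rewrite -leNgt => h0; exists 0; split; [|by rewrite r0 lexx|exact: E].
  rewrite (_ : mkset _ = set0) ?measure0 //.
  by apply/seteqP; split => s //= [_ _]; rewrite mulr0 addr0 ltNge h0.
- exists (Num.max 0 (r - Num.max 0 (- h / d))); split.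
  + rewrite -itvE; congr (lebesgue_measure _).
    apply/seteqP; split => s /=; rewrite in_itv /= gt_max ltr_pdivrMr //.
      by case=> -> ->; rewrite andbT -ltrBlDl sub0r => ->.
    by case/andP => /andP[-> ?] ->; split => //; rewrite -ltrBlDl sub0r.
  + by rewrite le_max lexx /= ge_max r0 /= lerBlDr lerDl le_max lexx.
  + have hd : d * (- h / d) = - h by rewrite mulrC divfK ?gt_eqF.
    have rd : 0 <= d * r by rewrite mulr_ge0 // ltW.
    rewrite maxr_pMr ?ltW // mulr0 mulrBr maxr_pMr ?ltW // mulr0 hd [r * d]mulrC.
    move: (d * r) rd => p p0.
    have [h0|h0] := leP 0 h; have [h1|h1] := leP 0 (- h); have [h2|h2] := leP 0 (h + p);
      case: leP; lra.
- exists (Num.max 0 (Num.min r (- h / d))); split.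
  + rewrite -[Num.min _ _]subr0 -itvE; congr (lebesgue_measure _).
    apply/seteqP; split => s /=; rewrite in_itv /= lt_min ltr_ndivlMr //.
      by case=> -> -> /=; rewrite -ltrBlDl sub0r => ->.
    by case/andP => -> /andP[-> ?]; split => //; rewrite -ltrBlDl sub0r.
  + by rewrite le_max lexx /= ge_max r0 /= ge_min lexx.
  + have hd : d * (- h / d) = - h by rewrite mulrC divfK ?lt_eqF.
    have rd : 0 <= - d * r by rewrite mulr_ge0 // oppr_ge0 ltW.
    have d0' : 0 <= - d by rewrite oppr_ge0 ltW.
    rewrite -[LHS]opprK -mulNr maxr_pMr // mulr0 minr_pMr // [- d * (- h / d)]mulNr hd opprK.
    rewrite -[r * d]opprK -mulrN [r * - d]mulrC.
    move: (- d * r) rd => p p0.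
    have [h0|h0] := leP 0 h; have [h1|h1] := leP p h; have [h2|h2] := leP 0 (h - p);
      case: leP; lra.
Qed.

Lemma negligible_exists d (T : measurableType d) (R : realType) (mu : {measure set T -> \bar R})
    (I : finType) (P : I -> T -> Prop) :
  (forall i, mu.-negligible [set x | P i x]) -> mu.-negligible [set x | exists i, P i x].
Proof.
move=> h; rewrite (_ : [set _ | _] = \big[setU/set0]_(i <- index_enum I) [set x | P i x]).
  apply: (big_ind mu.-negligible) => //; first exact: negligible_set0.
  by move=> A B; exact: negligibleU.
rewrite -bigcup_seq; apply/seteqP; split => x /=.
  by case=> i Px; exists i => //=; rewrite mem_index_enum.
by case=> i _ Px; exists i.
Qed.

Lemma bary_comb_cons (R : realType) n (l : 'I_n.+2 -> R) (s : R) (t : 'rV[R]_n) :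
  bary_comb l (cons_rv (s, t)) =
  bary_comb (l \o lift (lift ord0 ord0)) t + s * (l (lift ord0 ord0) - l ord0).
Proof.
rewrite /bary_comb big_ord_recl [in LHS]big_ord_recl [in RHS]big_ord_recl /=.
rewrite (_ : lift (lift ord0 ord0) ord0 = ord0); last exact/val_inj.
rewrite !baryS cons_rv0 !bary0 big_ord_recl cons_rv0.
rewrite [X in 1 - (_ + X)](eq_bigr (fun i => t 0 i)); last by move=> i _; rewrite cons_rvS.
rewrite [X in _ + (_ + X) = _](eq_bigr (fun i => l (lift ord0 (lift ord0 i)) * t 0 i)); last first.
  by move=> i _; rewrite baryS cons_rvS.
rewrite [X in _ = _ + X + _](eq_bigr (fun i => l (lift ord0 (lift ord0 i)) * t 0 i)); last first.
  by move=> i _; rewrite baryS; congr (l _ * _); exact/val_inj.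
by rewrite /=; ring.
Qed.

Lemma bary_comb_lift0 (R : realType) n (l : 'I_n.+2 -> R) (t : 'rV[R]_n) :
  bary_comb (l \o lift ord0) t =
  bary_comb (l \o lift (lift ord0 ord0)) t + bary t ord0 * (l (lift ord0 ord0) - l ord0).
Proof.
rewrite /bary_comb big_ord_recl [in RHS]big_ord_recl /=.
rewrite (_ : lift (lift ord0 ord0) ord0 = ord0); last exact/val_inj.
have -> : \sum_(i < n) l (lift (lift ord0 ord0) (lift ord0 i)) * bary t (lift ord0 i) =
  \sum_(i < n) l (lift ord0 (lift ord0 i)) * bary t (lift ord0 i).
  by apply: eq_bigr => i _; congr (l _ * _); exact/val_inj.
by ring.
Qed.

Lemma integrable_ref_simplex (R : realType) m (f : 'rV[R]_m -> R) (K : R) :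
  measurable_fun setT f -> (forall x, @ref_simplex R m x -> `|f x| <= K) ->
  (lebesgue_rv m).-integrable (@ref_simplex R m) (EFin \o f).
Proof.
move=> mf fK; apply: measurable_bounded_integrable.
- exact: measurable_ref_simplex.
- exact: ref_simplex_lty.
- exact: measurable_funTS.
- exists K; split; first exact: num_real.
  by move=> r Kr x /= /fK /le_trans; apply; exact: ltW.
Qed.

Lemma bary_comb_bound (R : realType) m (b : 'I_m.+1 -> R) (x : 'rV[R]_m) :
  @ref_simplex R m x -> `|bary_comb b x| <= \sum_k `|b k|.
Proof.
rewrite ref_simplexE => h; apply: le_trans (ler_norm_sum _ _ _) _.
apply: ler_sum => k _; rewrite normrM ler_piMr // ger0_norm //; exact: bary_le1.
Qed.

Lemma integrable_bary_comb (R : realType) m (b : 'I_m.+1 -> R) :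
  (lebesgue_rv m).-integrable (@ref_simplex R m) (EFin \o bary_comb b).
Proof.
apply: (integrable_ref_simplex (K := \sum_k `|b k|)); first exact: measurable_bary_comb.
exact: bary_comb_bound.
Qed.

Lemma integrable_pos_bary_comb (R : realType) m (b : 'I_m.+1 -> R) :
  (lebesgue_rv m).-integrable (@ref_simplex R m) (EFin \o (fun x => Num.max 0 (bary_comb b x))).
Proof.
apply: (integrable_ref_simplex (K := \sum_k `|b k|)); first exact: measurable_pos_bary_comb.
move=> x /(bary_comb_bound b); apply: le_trans.
by case: (leP 0 (bary_comb b x)) => // _; rewrite normr0.
Qed.

(** Cut the simplex into segments parallel to the edge from vertex 0 to vertex 1,
the other barycentric coordinates being fixed. Such a segment goes from the face
opposite to vertex 1 to the face opposite to vertex 0, and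
[lebesgue_segment_pos] applies to it. *)
Lemma simplex_divergence01 (R : realType) n (l : 'I_n.+2 -> R) :
  (l (lift ord0 ord0) - l ord0) *
    fine (lebesgue_rv n.+1 (@std_simplex R n.+1 `&` [set x | 0 < bary_comb l x])) =
  \int[lebesgue_rv n]_(t in @ref_simplex R n) Num.max 0 (bary_comb (l \o lift ord0) t) -
  \int[lebesgue_rv n]_(t in @ref_simplex R n) Num.max 0 (bary_comb (l \o lift (lift ord0 ord0)) t).
Proof.
pose d := l (lift ord0 ord0) - l ord0.
pose h := bary_comb (l \o lift (lift ord0 ord0)) : 'rV[R]_n -> R.
pose prod : {measure set (measurableTypeR R * 'rV[R]_n) -> \bar R} :=
  (@lebesgue_measure R \x lebesgue_rv n)%E.
pose A : set (measurableTypeR R * 'rV[R]_n) :=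
  @cons_rv R n @^-1` (@std_simplex R n.+1 `&` [set x | 0 < bary_comb l x]).
(* [A'] differs from [A] by a null set, and its section at a point of the closed
   reference face is exactly the segment of [lebesgue_segment_pos]. *)
pose A' := [set p : measurableTypeR R * 'rV[R]_n |
  [/\ 0 < p.1, p.1 < bary p.2 ord0, forall k, 0 <= p.2 0 k & 0 < h p.2 + p.1 * d]].
have mA : measurable A.
  rewrite -[X in measurable X]setTI; apply: measurable_cons_rv => //.
  apply: measurableI; first exact: measurable_std_simplex.
  by apply: measurable_pos_preimage; exact: measurable_bary_comb.
pose Z := [set t : 'rV[R]_n | exists k, t 0 k = 0].
have mcoord k : measurable_fun setT (fun p : measurableTypeR R * 'rV[R]_n => p.2 0 k).
  exact: (measurableT_comp (measurable_rv_coord k) measurable_snd).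
have mfst : measurable_fun setT (fun p : measurableTypeR R * 'rV[R]_n => p.1 : R) by exact: measurable_fst.
have mA' : measurable A'.
  have -> : A' = [set p : measurableTypeR R * 'rV[R]_n | 0 < p.1] `&`
      [set p : measurableTypeR R * 'rV[R]_n | 0 < bary p.2 ord0 - p.1] `&`
      [set p : measurableTypeR R * 'rV[R]_n | forall k, 0 <= p.2 0 k] `&`
      [set p : measurableTypeR R * 'rV[R]_n | 0 < h p.2 + p.1 * d].
    by apply/seteqP; split => p /=; rewrite subr_gt0; [case|case=> -[[]]].
  apply: measurableI; [apply: measurableI; [apply: measurableI|]|].
  - exact: measurable_pos_preimage.
  - apply: measurable_pos_preimage; apply: measurable_funB => //.
    exact: (measurableT_comp (measurable_bary ord0) measurable_snd).
  - by apply: measurable_forall => k; exact: measurable_nneg_preimage.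
  - apply: measurable_pos_preimage; apply: measurable_funD.
      exact: (measurableT_comp (measurable_bary_comb _) measurable_snd).
    exact: measurable_funM.
have AE (s : R) (t : 'rV[R]_n) : A (s, t) <->
    [/\ 0 < s, s < bary t ord0, forall k, 0 < t 0 k & 0 < h t + s * d].
  rewrite /A /= bary_comb_cons; split.
    case=> S ->; split => //.
    - by have := S (lift ord0 ord0); rewrite baryS cons_rv0.
    - have := S ord0; rewrite bary0 big_ord_recl cons_rv0 opprD addrA addrAC subr_gt0.
      by rewrite (eq_bigr (fun i => t 0 i)) -?bary0 // => i _; rewrite cons_rvS.
    - by move=> k; have := S (lift ord0 (lift ord0 k)); rewrite baryS cons_rvS.
  case=> s0 sr t0 ->; split => // k; case: (unliftP ord0 k) => [j ->|->].
    rewrite baryS; case: (unliftP ord0 j) => [i ->|->]; first by rewrite cons_rvS.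
    by rewrite (_ : ord0 = 0) // cons_rv0.
  rewrite bary0 big_ord_recl cons_rv0 opprD addrA addrAC subr_gt0.
  by rewrite (eq_bigr (fun i => t 0 i)) -?bary0 // => i _; rewrite cons_rvS.
have nZ : (lebesgue_rv n).-negligible Z.
  apply: negligible_exists => k.
  rewrite (_ : [set _ | _] = hyperplane (delta_mx 0 k) 0).
    apply/negligibleP; first exact: measurable_hyperplane.
    apply: lebesgue_rv_hyperplane; apply/eqP => /matrixP /(_ 0 k) /eqP.
    by rewrite !mxE !eqxx oner_eq0.
  apply/seteqP; split => t; rewrite /hyperplane /= dotpE (bigD1 k) //= mxE !eqxx mulr1 big1 ?addr0 //.
    by move=> j jk; rewrite mxE (negbTE jk) andbF mulr0.
  by move=> j jk; rewrite mxE (negbTE jk) andbF mulr0.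
have AA' : prod A = prod A'.
  have [N [mN N0 ZN]] := nZ.
  have mTN : measurable ([set: measurableTypeR R] `*` N) by exact: measurableX.
  have N0' : prod ([set: measurableTypeR R] `*` N) = 0%E.
    by apply: etrans (product_measure1E _ _ measurableT mN) _; rewrite N0 mule0.
  rewrite -(measureU0 mA mTN N0') -(measureU0 mA' mTN N0'); congr (prod _).
  apply/seteqP; split => -[s t] [H|H]; [left| by right| |by right].
    by have [] := (AE s t).1 H => s0 sr t0 hd; split => // k; exact/ltW/t0.
  have [s0 sr t0 hd] := H; have [Zt|Zt] := pselect (Z t); first by right; split => //; exact: ZN.
  left; apply/AE; split => // k; rewrite lt_neqAle t0 andbT eq_sym.
  by apply/eqP => tk; apply: Zt; exists k.
have -> : lebesgue_rv n.+1 (@std_simplex R n.+1 `&` [set x | 0 < bary_comb l x]) = prod A by [].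
have -> : prod A = (lebesgue_measure \x^ lebesgue_rv n)%E A'.
  rewrite AA'; apply: (@product_measure_unique _ _ _ _ R (@lebesgue_measure R)
    (lebesgue_rv n) (lebesgue_measure \x^ lebesgue_rv n)%E) => // B C mB mC.
  exact: product_measure2E.
pose g t := fine (lebesgue_measure (ysection A' t)).
have gP t : [/\ lebesgue_measure (ysection A' t) = (g t)%:E, 0 <= g t,
    @ref_simplex R n t -> g t <= 1 /\ d * g t = Num.max 0 (h t + bary t ord0 * d) - Num.max 0 (h t)
    & ~ @ref_simplex R n t -> g t = 0].
  rewrite /g; have [St|St] := pselect (@ref_simplex R n t).
    have := St; rewrite {1}ref_simplexE => /= St'.
    have [L [EL /andP[L0 Lr] dL]] := lebesgue_segment_pos (h t) d (St' ord0).
    have -> : ysection A' t = [set s : R | [/\ 0 < s, s < bary t ord0 & 0 < h t + s * d]].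
      apply/seteqP; split => s; rewrite /ysection /= inE /A' /=; first by case.
      by case=> *; split => // k; rewrite -baryS.
    rewrite EL /=; split => // _; split => //.
    by apply: le_trans Lr _; exact: bary_le1.
  have -> : ysection A' t = set0.
    apply/seteqP; split => s //; rewrite /ysection /= inE /A' /= => -[s0 sr t0 _].
    apply: St; rewrite ref_simplexE => k; case: (unliftP ord0 k) => [j ->|->]; first by rewrite baryS.
    by rewrite ltW // (lt_trans s0).
  by rewrite measure0.
have mg : measurable_fun setT g.
  apply/measurable_EFinP.
  rewrite (_ : EFin \o g = @lebesgue_measure R \o ysection A').
    exact: (measurable_fun_ysection (@lebesgue_measure R) mA').
  by apply/funext => t /=; have [->] := gP t.
have Ig : (lebesgue_rv n).-integrable (@ref_simplex R n) (EFin \o g).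
  apply: (integrable_ref_simplex (K := 1)) => // t St.
  by have [_ g0 /(_ St)[g1 _] _] := gP t; rewrite ger0_norm.
have -> : fine ((lebesgue_measure \x^ lebesgue_rv n)%E A') = \int[lebesgue_rv n]_(t in @ref_simplex R n) g t.
  rewrite /Rintegral; congr fine; rewrite [RHS]integral_mkcond.
  apply: eq_integral => t _ /=; rewrite /patch; have [-> _ _ g0] := gP t.
  by case: ifPn => // /negP St; rewrite g0 // => ?; apply: St; exact: mem_set.
rewrite -/d -RintegralZl //; last exact: measurable_ref_simplex.
rewrite -RintegralB; last 3 first.
- exact: measurable_ref_simplex.
- exact: integrable_pos_bary_comb.
- exact: integrable_pos_bary_comb.
apply: eq_Rintegral => t /set_mem St.
by have [_ _ /(_ St)[_ ->] _] := gP t; rewrite bary_comb_lift0.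
Qed.

Lemma perm_liftE n (s : {perm 'I_n.+2}) (k : 'I_n.+2) :
  exists s' : {perm 'I_n.+1}, forall x, s (lift k x) = lift (s k) (s' x).
Proof.
pose f x := odflt x (unlift (s k) (s (lift k x))).
have fE x : s (lift k x) = lift (s k) (f x).
  rewrite /f; case: unliftP => [y -> //|/perm_inj /eqP].
  by rewrite eq_sym (negbTE (neq_lift _ _)).
have f_inj : injective f.
  move=> x y fxy; have : s (lift k x) = s (lift k y) by rewrite !fE fxy.
  by move=> /perm_inj /lift_inj.
by exists (perm f_inj) => x; rewrite permE.
Qed.

Lemma perm_pair n (i j : 'I_n.+2) : i != j ->
  exists2 s : {perm 'I_n.+2}, s ord0 = i & s (lift ord0 ord0) = j.
Proof.
move=> ij; pose s1 := tperm ord0 i.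
exists (tperm (lift ord0 ord0) (s1 j) * s1)%g; rewrite permM; last by rewrite tpermL tpermK.
rewrite (_ : tperm (lift ord0 ord0) (s1 j) ord0 = ord0) ?tpermL //; apply: tpermD => //.
apply: contra_neq ij => s1j; by rewrite -(tpermK ord0 i j) -/s1 s1j tpermL.
Qed.

(** The divergence theorem for the positive part of an affine function with vertex
values [l], tested against the direction of the edge from vertex [i] to vertex
[j]: only the faces [i] and [j] contribute to the boundary integral. It reduces
to the edge from 0 to 1 because both sides are invariant under a permutation of
the vertices. *)
Lemma simplex_divergence (R : realType) n (l : 'I_n.+2 -> R) (i j : 'I_n.+2) :
  (l j - l i) *
    fine (lebesgue_rv n.+1 (@std_simplex R n.+1 `&` [set x | 0 < bary_comb l x])) =
  \int[lebesgue_rv n]_(t in @ref_simplex R n) Num.max 0 (bary_comb (l \o lift i) t) -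
  \int[lebesgue_rv n]_(t in @ref_simplex R n) Num.max 0 (bary_comb (l \o lift j) t).
Proof.
have [->|ij] := eqVneq i j; first by rewrite !subrr mul0r.
have [s si sj] := perm_pair ij.
have E k : \int[lebesgue_rv n]_(t in @ref_simplex R n) Num.max 0 (bary_comb ((l \o s) \o lift k) t) =
    \int[lebesgue_rv n]_(t in @ref_simplex R n) Num.max 0 (bary_comb (l \o lift (s k)) t).
  have [s' s'E] := perm_liftE s k.
  rewrite -[RHS](integral_ref_simplex_perm (s'^-1)%g (measurable_pos_bary_comb _)); last first.
    by move=> x; rewrite le_max lexx.
  apply: eq_Rintegral => t _; rewrite bary_comb_perm invgK; congr (Num.max 0 (bary_comb _ t)).
  by apply/funext => x /=; rewrite s'E.
by have := simplex_divergence01 (l \o s); rewrite !E /= si sj lebesgue_rv_perm_bary.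
Qed.

(** A barycentric coordinate is its own positive part, and it vanishes on one face,
so that its integral over another face is given by [simplex_divergence]. This
determines all integrals of affine functions over faces, and no volume has to be
computed. *)
Lemma integral_bary (R : realType) n (k : 'I_n.+1) :
  \int[lebesgue_rv n]_(t in @ref_simplex R n) bary t k =
  fine (lebesgue_rv n.+1 (@std_simplex R n.+1)).
Proof.
pose l (m : 'I_n.+2) : R := (m == lift ord0 k)%:R.
have lE x : bary_comb l x = bary x (lift ord0 k).
  rewrite /bary_comb (bigD1 (lift ord0 k)) //= /l eqxx mul1r big1 ?addr0 // => m.
  by move=> /negbTE ->; rewrite mul0r.
have := simplex_divergence l ord0 (lift ord0 k).
rewrite {1 2}/l eqxx /= subr0 mul1r.
rewrite (_ : _ `&` _ = @std_simplex R n.+1); last first.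
  by apply/seteqP; split => [x []//|x Sx]; split => //=; rewrite lE.
move=> ->; rewrite [X in _ = _ - X](_ : _ = 0); last first.
  rewrite (@eq_Rintegral _ _ _ _ _ (cst 0)).
    by rewrite Rintegral_cst ?mul0r //; exact: measurable_ref_simplex.
  move=> t _; rewrite /bary_comb big1 ?maxxx // => m _ /=.
  by rewrite /l eq_sym (negbTE (neq_lift _ _)) mul0r.
rewrite subr0; apply: eq_Rintegral => t /set_mem; rewrite ref_simplexE => St.
rewrite (_ : bary_comb _ t = bary t k); first by apply/esym/max_idPr; exact: St.
rewrite /bary_comb (bigD1 k) //= /l eqxx mul1r big1 ?addr0 // => m mk.
by rewrite (inj_eq lift_inj) (negbTE mk) mul0r.
Qed.

Lemma integral_bary_comb (R : realType) n (b : 'I_n.+1 -> R) :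
  \int[lebesgue_rv n]_(t in @ref_simplex R n) bary_comb b t =
  (\sum_k b k) * fine (lebesgue_rv n.+1 (@std_simplex R n.+1)).
Proof.
have mS := @measurable_ref_simplex R n.
have Ib (b' : R) k : (lebesgue_rv n).-integrable (@ref_simplex R n) (EFin \o (fun t => b' * bary t k)).
  apply: (integrable_ref_simplex (K := `|b'|)).
    by apply: measurable_funM => //; exact: measurable_bary.
  move=> x; rewrite ref_simplexE => Sx.
  by rewrite normrM ler_piMr // ger0_norm //; exact: bary_le1.
have Ib1 k : (lebesgue_rv n).-integrable (@ref_simplex R n) (EFin \o (fun t => bary t k)).
  by apply: eq_integrable (Ib 1 k) => // t _ /=; rewrite mul1r.
rewrite /bary_comb mulr_suml; elim: (index_enum _) => [|k r IH].
  rewrite big_nil (@eq_Rintegral _ _ _ _ _ (cst 0)); last by move=> t _; rewrite big_nil.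
  by rewrite Rintegral_cst // mul0r.
rewrite big_cons -IH -(@integral_bary R n k) -RintegralZl // -RintegralD //.
  by apply: eq_Rintegral => t _; rewrite big_cons.
apply: (integrable_ref_simplex (K := \sum_(i <- r) `|b i|)).
  apply: measurable_sum => i; apply: measurable_funM => //; exact: measurable_bary.
move=> x; rewrite ref_simplexE => h; apply: le_trans (ler_norm_sum _ _ _) _.
apply: ler_sum => i _; rewrite normrM ler_piMr // ger0_norm //; exact: bary_le1.
Qed.

(** Integrate the constant 1, which is the sum of the barycentric coordinates. *)
Lemma ref_simplex_std (R : realType) n :
  fine (lebesgue_rv n (@ref_simplex R n)) =
  n.+1%:R * fine (lebesgue_rv n.+1 (@std_simplex R n.+1)).
Proof.
have := integral_bary_comb (fun _ : 'I_n.+1 => 1 : R).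
rewrite sumr_const card_ord => <-.
rewrite (@eq_Rintegral _ _ _ _ _ (cst 1)).
  by rewrite Rintegral_cst ?mul1r //; exact: measurable_ref_simplex.
by move=> t _; rewrite /bary_comb; under eq_bigr do rewrite mul1r; rewrite sum_bary.
Qed.

(** * Scalar product and affine functions *)

Section dot_product.
Context (R : realType) (m : nat).
Implicit Types (u v w x y : 'rV[R]_m) (k : R).

Lemma dotpC u v : dotp u v = dotp v u.
Proof. by rewrite !dotpE; apply: eq_bigr => i _; rewrite mulrC. Qed.

Lemma dotpDl u v w : dotp (u + v) w = dotp u w + dotp v w.
Proof. by rewrite /dotp mulmxDl mxE. Qed.

Lemma dotpZl k u w : dotp (k *: u) w = k * dotp u w.
Proof. by rewrite /dotp -scalemxAl mxE. Qed.

Lemma dotpNl u w : dotp (- u) w = - dotp u w.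
Proof. by rewrite -scaleN1r dotpZl mulN1r. Qed.

Lemma dotpBl u v w : dotp (u - v) w = dotp u w - dotp v w.
Proof. by rewrite dotpDl dotpNl. Qed.

Lemma dotp0l w : dotp 0 w = 0.
Proof. by rewrite /dotp mul0mx mxE. Qed.

Lemma dotpDr u v w : dotp w (u + v) = dotp w u + dotp w v.
Proof. by rewrite dotpC dotpDl !(dotpC w). Qed.

Lemma dotpZr k u w : dotp w (k *: u) = k * dotp w u.
Proof. by rewrite dotpC dotpZl (dotpC w). Qed.

Lemma dotpBr u v w : dotp w (u - v) = dotp w u - dotp w v.
Proof. by rewrite dotpC dotpBl !(dotpC w). Qed.

Lemma dotp_suml I (r : seq I) (F : I -> 'rV[R]_m) w :
  dotp (\sum_(i <- r) F i) w = \sum_(i <- r) dotp (F i) w.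
Proof.
elim: r => [|i r IH]; first by rewrite !big_nil dotp0l.
by rewrite !big_cons dotpDl IH.
Qed.

Lemma dotp_ge0 u : 0 <= dotp u u.
Proof. by rewrite dotpE; apply: sumr_ge0 => i _; rewrite -expr2 sqr_ge0. Qed.

Lemma dotp_eq0 u : dotp u u = 0 -> u = 0.
Proof.
rewrite dotpE => /psumr_eq0P H; apply/rowP => i; rewrite mxE.
by apply/eqP; rewrite -sqrf_eq0 expr2 H // => j _; rewrite -expr2 sqr_ge0.
Qed.

Lemma enorm_unit u : enorm u = 1 -> dotp u u = 1.
Proof. by move=> h; rewrite -[LHS]sqr_sqrtr ?dotp_ge0 // -/(enorm u) h expr1n. Qed.

(** Cauchy-Schwarz: the square of the part of [u] orthogonal to [v] is
nonnegative. *)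
Lemma dotp_le_enorm u v : enorm v = 1 -> dotp u v <= enorm u.
Proof.
move=> /enorm_unit v1; have := dotp_ge0 (u - dotp u v *: v).
rewrite dotpBl !dotpBr !dotpZl !dotpZr v1 (dotpC v u) => h.
apply: le_trans (ler_norm _) _; rewrite -sqrtr_sqr ler_sqrt ?dotp_ge0 // expr2.
by lra.
Qed.

Lemma continuous_dotp u : continuous (fun x => dotp u x).
Proof.
move=> x; rewrite (_ : (fun _ => _) = fun y : 'rV[R]_m => \sum_i u 0 i * y 0 i); last first.
  by apply/funext => y; rewrite dotpE.
elim: (index_enum _) x => [|i r IH] x.
  rewrite (_ : (fun _ => _) = cst 0); first exact: cst_continuous.
  by apply/funext => y; rewrite big_nil.
rewrite (_ : (fun _ => _) = fun y : 'rV[R]_m => u 0 i * y 0 i + \sum_(j <- r) u 0 j * y 0 j).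
  have ci : {for x, continuous (fun y : 'rV[R]_m => u 0 i * y 0 i)}.
    exact: (cvgM (@cst_continuous _ _ (u 0 i) x) (@coord_continuous R 1 m 0 i x)).
  exact: (cvgD ci (IH x)).
by apply/funext => y; rewrite big_cons.
Qed.

Lemma continuous_affine (c : R) u : continuous (fun x => c + dotp u x).
Proof.
move=> x; have cc : {for x, continuous (fun=> c : R)} by exact: cst_continuous.
exact: (cvgD cc (@continuous_dotp u x)).
Qed.

Lemma derive_affine (c : R) u v x : 'D_v (fun y => c + dotp u y) x = dotp u v.
Proof.
rewrite /derive; apply: cvg_lim => //.
apply: cvg_near_cst; near=> h.
have h0 : h != 0 by near: h; exact: nbhs_dnbhs_neq.
rewrite /= dotpDr dotpZr [X in h^-1 *: X](_ : _ = h * dotp u v); last by ring.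
by rewrite /GRing.scale /= mulKf.
Unshelve. all: by end_near. Qed.

End dot_product.

(** * Traces of continuous functions *)

Section traces.
Context (R : realType) (m : nat).
Implicit Types (D : set 'rV[R]_m) (f F : 'rV[R]_m -> R) (x : 'rV[R]_m).

Lemma open_not_negligible D x : nbhs x D -> ~ (lebesgue_rv m).-negligible D.
Proof.
move=> /nbhs_ballP[e /= e0 eD] /(negligibleS eD).
move=> /(negligibleP _ (measurable_ball_rv x e0)).1.
move=> /(etrans (esym (lebesgue_rv_ball x e0))) /eqP.
by rewrite eqe gt_eqF // exprn_gt0 // mulrn_wgt0.
Qed.

(** The essential limit of a function at [x] along [D] is unique when [D] has
positive measure near [x]. For open [D] this says that [x] is in the closure. *)
Definition thick_at D x := forall r, 0 < r -> ~ (lebesgue_rv m).-negligible (D `&` ball x r).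

Lemma open_thick D x : open D -> (forall r, 0 < r -> exists2 y, D y & ball x r y) -> thick_at D x.
Proof.
move=> oD hD r r0; have [y Dy xy] := hD r r0.
apply: (@open_not_negligible _ y); apply: filterI; first exact: open_nbhs_nbhs.
exact: open_nbhs_nbhs (conj (ball_open x r) xy).
Qed.

Lemma trace_continuous D f F x :
  thick_at D x -> {for x, continuous F} ->
  {ae lebesgue_rv m, forall y, D y -> f y = F y} -> trace D f x = F x.
Proof.
move=> tD cF fF; apply: get_unique => [e e0|l hl] /=.
  have /cvgrPdist_lt /(_ e e0) /nbhs_ballP[r /= r0 hr] := cF.
  exists r => //; apply: filterS fF => y fFy Dy /hr /=.
  by rewrite fFy // distrC.
apply/eqP; rewrite -subr_eq0 -normr_eq0; apply/negPn/negP => lF.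
have d0 : 0 < `|l - F x| / 2 by rewrite divr_gt0 // lt_neqAle eq_sym lF normr_ge0.
have [r r0 hr] := hl _ d0.
have /cvgrPdist_lt /(_ _ d0) /nbhs_ballP[r' /= r0' hr'] := cF.
apply: (tD (Num.min r r')); first by rewrite lt_min r0.
have [N [mN N0 sN]] := filterI fF hr.
exists N; split => // y [Dy xy]; apply: sN => -[fFy /(_ Dy)].
have xry : ball x r y by apply: le_ball xy; rewrite ge_min lexx.
have xr'y : ball x r' y by apply: le_ball xy; rewrite ge_min lexx orbT.
move=> /(_ xry); have := hr' y xr'y; rewrite /= fFy // => h1 h2.
have := ler_normD (l - F y) (F y - F x); rewrite addrA subrK.
rewrite (distrC l (F y)) (distrC (F y) (F x)).
by lra.
Qed.

End traces.

(** * Gram determinants *)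

(** On the segment from the identity to [A] all matrices are positive definite,
hence invertible. The determinant is a polynomial function on that segment that
does not vanish and is 1 at the identity. *)
Lemma det_posdef_gt0 (R : realType) n (A : 'M[R]_n) :
  (forall v : 'rV[R]_n, v != 0 -> 0 < dotp (v *m A) v) -> 0 < \det A.
Proof.
move=> posA.
pose M : 'M[{poly R}]_n := (1 - 'X)%:M + 'X *: map_mx polyC A.
have detM t : (\det M).[t] = \det ((1 - t)%:M + t *: A).
  have -> : (1 - t)%:M + t *: A = map_mx (horner_eval t) M.
    apply/matrixP => i j; rewrite !mxE /horner_eval !hornerE.
    by case: (i == j); rewrite ?mulr1n ?mulr0n !hornerE.
  by rewrite det_map_mx.
have noroot t : 0 <= t <= 1 -> ~~ root (\det M) t.
  move=> /andP[t0 t1]; rewrite /root detM; apply/det0P => -[v v0].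
  rewrite mulmxDr -scalemxAr mul_mx_scalar => /(congr1 (fun u => dotp u v)).
  rewrite dotpDl !dotpZl dotp0l => /eqP; apply/negP; rewrite gt_eqF //.
  have vv : 0 < dotp v v.
    by rewrite lt_neqAle dotp_ge0 andbT eq_sym; apply: contra_neq v0 => /dotp_eq0.
  have vA := posA v v0.
  have [->|t0'] := eqVneq t 0; first by rewrite subr0 mul1r mul0r addr0.
  by rewrite ltr_wpDl ?mulr_ge0 ?subr_ge0 ?(ltW vv) // mulr_gt0 // lt_neqAle eq_sym t0'.
have M0 : (\det M).[0] = 1 by rewrite detM subr0 scale0r addr0 det1.
have M1 : (\det M).[1] = \det A.
  by rewrite detM subrr scale1r (_ : 0%:M = 0) ?add0r //; apply/matrixP => i j; rewrite !mxE mul0rn.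
rewrite ltNge; apply/negP => Aneg.
have [|t t01] := @poly_ivt R (- \det M) 0 1 ler01.
  by rewrite !hornerN M0 M1 oppr_le0 ler01 oppr_ge0.
by rewrite rootN => rt; have := noroot t t01; rewrite rt.
Qed.

Lemma gram_det_gt0 (R : realType) n m (E : 'M[R]_(n, m)) :
  (forall v : 'rV[R]_n, v *m E = 0 -> v = 0) -> 0 < \det (E *m E^T).
Proof.
move=> freeE; apply: det_posdef_gt0 => v v0.
have -> : dotp (v *m (E *m E^T)) v = dotp (v *m E) (v *m E).
  by rewrite /dotp trmx_mul !mulmxA.
rewrite lt_neqAle dotp_ge0 andbT eq_sym; apply: contra_neq v0 => /dotp_eq0.
exact: freeE.
Qed.

(** * Geometry of a nondegenerate simplex *)

Lemma open_forall (T : topologicalType) (I : finType) (P : I -> T -> Prop) :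
  (forall i, open [set x | P i x]) -> open [set x | forall i, P i x].
Proof.
move=> oP; rewrite openE => x Px; rewrite /interior.
apply: (@filter_forall _ _ P (nbhs x)) => i.
exact: open_nbhs_nbhs (conj (oP i) (Px i)).
Qed.

Section simplex_geometry.
Context (R : realType) (n : nat) (a : 'I_n.+2 -> 'rV[R]_n.+1).
Context (a_nondeg : Defs.nondegenerate a).
Implicit Types (x y g : 'rV[R]_n.+1) (k : 'I_n.+2) (c : R).

Let edges : 'M[R]_n.+1 := \matrix_(i < n.+1) (a (lift ord0 i) - a ord0).

(** The affine map that sends the vertices of the reference simplex to the points
[a k], and its inverse. *)
Definition of_bary x : 'rV[R]_n.+1 := a ord0 + x *m edges.

Definition to_bary y : 'rV[R]_n.+1 := (y - a ord0) *m invmx edges.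

Lemma of_baryE x : of_bary x = \sum_k bary x k *: a k.
Proof.
rewrite /of_bary big_ord_recl bary0 scalerBl scale1r mulmx_sum_row -addrA; congr (_ + _).
rewrite scaler_suml -sumrN -big_split /=; apply: eq_bigr => i _.
by rewrite rowK baryS scalerBr addrC.
Qed.

Lemma of_baryK : cancel of_bary to_bary.
Proof. by move=> x; rewrite /to_bary /of_bary addrC addKr mulmxK. Qed.

Lemma to_baryK : cancel to_bary of_bary.
Proof. by move=> y; rewrite /to_bary /of_bary mulmxKV // addrC subrK. Qed.

Lemma of_baryD x y : of_bary (x + y *m invmx edges) = of_bary x + y.
Proof. by rewrite /of_bary mulmxDl mulmxKV // addrA. Qed.

Lemma affine_of_bary c g x :
  c + dotp g (of_bary x) = bary_comb (fun k => c + dotp g (a k)) x.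
Proof.
rewrite /bary_comb of_baryE dotpC dotp_suml -[X in X + _]mul1r -(sum_bary x) mulr_suml -big_split /=.
by apply: eq_bigr => k _; rewrite dotpZl mulrDl (dotpC g); ring.
Qed.

Lemma measurable_of_bary : measurable_fun setT of_bary.
Proof.
apply: measurable_fun_rvP => j; rewrite (_ : (fun _ => _) = bary_comb (fun k => a k 0 j)).
  exact: measurable_bary_comb.
apply/funext => x; rewrite of_baryE summxE /bary_comb; apply: eq_bigr => k _.
by rewrite mxE mulrC.
Qed.

Lemma dotp_edge g i : dotp (a (lift ord0 i) - a ord0) g = (edges *m g^T) i 0.
Proof. by rewrite dotpE mxE; apply: eq_bigr => j _; rewrite !mxE. Qed.

Lemma affine_interpolation (p : 'I_n.+2 -> R) :
  exists c g, forall k, c + dotp g (a k) = p k.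
Proof.
pose u : 'cV[R]_n.+1 := invmx edges *m \col_i (p (lift ord0 i) - p ord0).
exists (p ord0 - dotp u^T (a ord0)), u^T => k.
case: (unliftP ord0 k) => [i ->|->]; last by rewrite subrK.
have := dotp_edge u^T i; rewrite trmxK /u mulKVmx // mxE dotpBl !(dotpC _ (_^T)).
by move=> h; lra.
Qed.

Lemma bary_to_bary k : exists c g,
  (forall y, bary (to_bary y) k = c + dotp g y) /\
  forall m, c + dotp g (a m) = (m == k)%:R.
Proof.
have [c [g hg]] := affine_interpolation (fun m => (m == k)%:R).
exists c, g; split => // y; rewrite -{2}(to_baryK y) affine_of_bary /bary_comb.
rewrite (bigD1 k) //= hg eqxx mul1r big1 ?addr0 // => m mk.
by rewrite hg (negbTE mk) mul0r.
Qed.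

Lemma simplexE : simplex a = [set y | forall k, 0 < bary (to_bary y) k].
Proof.
apply/seteqP; split => y /=.
  case=> l [l0 l1 ->] k.
  have -> : \sum_i l i *: a i = of_bary (\row_j l (lift ord0 j)).
    rewrite of_baryE; apply: eq_bigr => i _; congr (_ *: _).
    case: (unliftP ord0 i) => [j ->|->]; first by rewrite baryS mxE.
    rewrite bary0 -l1 big_ord_recl; under [X in _ = _ - X]eq_bigr do rewrite mxE.
    by rewrite addrK.
  rewrite of_baryK; case: (unliftP ord0 k) => [j ->|->]; first by rewrite baryS mxE.
  rewrite bary0 -l1 big_ord_recl; under [X in _ - X]eq_bigr do rewrite mxE.
  by rewrite addrK.
move=> h; exists (bary (to_bary y)); split => //; first exact: sum_bary.
by rewrite -of_baryE to_baryK.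
Qed.

Lemma simplex_of_bary x : simplex a (of_bary x) <-> std_simplex x.
Proof. by rewrite simplexE /= of_baryK. Qed.

Lemma measurable_affine c g : measurable_fun setT (fun y => c + dotp g y).
Proof.
rewrite (_ : (fun _ => _) = fun y => c + dotp y g).
  by apply: measurable_funD => //; exact: measurable_dotp.
by apply/funext => y; rewrite dotpC.
Qed.

Lemma measurable_simplex : measurable (simplex a).
Proof.
rewrite simplexE; apply: measurable_forall => k; apply: measurable_pos_preimage.
have [c [g [hg _]]] := bary_to_bary k; under eq_fun do rewrite hg.
exact: measurable_affine.
Qed.

Lemma open_affine_gt0 c g : open [set y : 'rV[R]_n.+1 | 0 < c + dotp g y].
Proof.
rewrite openE => y /= y0; rewrite /interior.
exact: (@cvgr_gt R _ (nbhs y) _ _ _ (@continuous_affine R n.+1 c g y) 0 y0).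
Qed.

Lemma open_simplex : open (simplex a).
Proof.
rewrite simplexE; apply: open_forall => k.
have [c [g [hg _]]] := bary_to_bary k.
rewrite (_ : [set _ | _] = [set y | 0 < c + dotp g y]); last first.
  by apply/seteqP; split => z /=; rewrite hg.
exact: open_affine_gt0.
Qed.

(** The difference of the gradients is orthogonal to the edges from [a ord0], which
form a basis. *)
Lemma affine_vertex_inj c c' g g' :
  (forall k, c + dotp g (a k) = c' + dotp g' (a k)) -> g = g' /\ c = c'.
Proof.
move=> h; have gg' : g = g'.
  apply/eqP; rewrite -subr_eq0; apply/eqP; apply: trmx_inj; rewrite trmx0.
  rewrite -[LHS](mulKmx a_nondeg) -/edges (_ : edges *m _ = 0) ?mulmx0 //.
  apply/colP => i; rewrite [RHS]mxE -dotp_edge dotpBl !dotpBr.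
  have := h (lift ord0 i); have := h ord0; rewrite !(dotpC _ g) !(dotpC _ g'); lra.
by split => //; have := h ord0; rewrite gg' => /addIr.
Qed.

Lemma face_paramE i (t : 'rV[R]_n) :
  face_param a i t = \sum_k bary t k *: a (lift i k).
Proof.
rewrite /face_param mulmx_sum_row [RHS]big_ord_recl bary0 scalerBl scale1r -addrA; congr (_ + _).
rewrite scaler_suml -sumrN -big_split /=; apply: eq_bigr => k _.
by rewrite rowK baryS scalerBr addrC.
Qed.

Lemma affine_face_param c g i (t : 'rV[R]_n) :
  c + dotp g (face_param a i t) = bary_comb ((fun k => c + dotp g (a k)) \o lift i) t.
Proof.
rewrite /bary_comb face_paramE dotpC dotp_suml -[X in X + _]mul1r -(sum_bary t) mulr_suml -big_split /=.
by apply: eq_bigr => k _; rewrite dotpZl mulrDl (dotpC g); ring.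
Qed.

(** The edge vectors of a face are independent: a vanishing combination is seen by
the affine functions equal to 1 at one vertex and to 0 at the others. *)
Lemma face_gram_gt0 i : 0 < \det (face_edges a i *m (face_edges a i)^T).
Proof.
apply: gram_det_gt0 => v vE.
have fE g c : dotp g (v *m face_edges a i) =
    \sum_k v 0 k * ((c + dotp g (a (lift i (lift ord0 k)))) - (c + dotp g (a (lift i ord0)))).
  rewrite mulmx_sum_row dotpC dotp_suml; apply: eq_bigr => k _.
  by rewrite dotpZl rowK dotpBl !(dotpC _ g); congr (_ * _); ring.
apply/rowP => k; rewrite mxE.
pose p (m : 'I_n.+2) : R := (m == lift i (lift ord0 k))%:R.
have [c [g hg]] := affine_interpolation p.
have := fE g c; rewrite vE dotpC dotp0l (bigD1 k) //= !hg /p eqxx.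
rewrite (inj_eq lift_inj) (_ : (ord0 == lift ord0 k) = false) ?subr0 ?mulr1 //.
rewrite big1 ?addr0 // => j jk; rewrite !hg /p !(inj_eq lift_inj) (negbTE jk).
by rewrite subr0 mulr0.
Qed.

End simplex_geometry.

(** * Means over the faces *)

Lemma small_step (R : realType) m (x w : 'rV[R]_m.+1) (r : R) : 0 < r ->
  exists2 e, 0 < e <= 1 & ball x r (x + e *: w).
Proof.
move=> r0; pose q := r / (1 + `|w|).
have p1 : 0 < 1 + `|w| by rewrite ltr_wpDr.
have q0 : 0 < q by rewrite divr_gt0.
exists (Num.min 1 q); first by rewrite lt_min ltr01 q0 ge_min lexx.
rewrite -ball_normE /= opprD addrA subrr sub0r normrN normrZ gtr0_norm; last by rewrite lt_min ltr01.
apply: (@le_lt_trans _ _ (q * `|w|)); first by rewrite ler_wpM2r // ge_min lexx orbT.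
by rewrite -[X in _ < X](divfK (lt0r_neq0 p1)) -/q ltr_pM2l // ltrDr.
Qed.

(** The points [x + e *: (z - x)] are in [D] and tend to [x]. *)
Lemma star_thick (R : realType) m (D : set 'rV[R]_m.+1) (x z : 'rV[R]_m.+1) :
  open D -> (forall e, 0 < e <= 1 -> D (x + e *: (z - x))) -> thick_at D x.
Proof.
move=> oD starD; apply: open_thick => // r r0.
have [e e01 xe] := small_step x (z - x) r0.
by exists (x + e *: (z - x)); first exact: starD.
Qed.

Lemma continuous_pos_affine (R : realType) n (c : R) g :
  continuous (fun y : 'rV[R]_n.+1 => Num.max 0 (c + dotp g y)).
Proof.
move=> x; apply: (@continuous_max R _ (fun=> 0) (fun y => c + dotp g y)).
  exact: cst_continuous.
exact: continuous_affine.
Qed.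

Lemma continuous_affine_pos (R : realType) n (c : R) g (c' : R) g' (k : R) :
  continuous (fun y : 'rV[R]_n.+1 => c + dotp g y + k * Num.max 0 (c' + dotp g' y)).
Proof.
move=> x.
have cM : {for x, continuous (fun y => k * Num.max 0 (c' + dotp g' y))}.
  exact: (cvgM (@cst_continuous _ _ k x) (@continuous_pos_affine R n c' g' x)).
exact: (cvgD (@continuous_affine R n.+1 c g x) cM).
Qed.

Section crouzeix_raviart.
Context (R : realType) (n : nat) (a : 'I_n.+2 -> 'rV[R]_n.+1).
Context (a_nondeg : Defs.nondegenerate a).
Implicit Types (x y g : 'rV[R]_n.+1) (k i j : 'I_n.+2) (c : R).

Let Rv := fine (lebesgue_rv n (@ref_simplex R n)).

Let Rv_gt0 : 0 < Rv.
Proof. by apply: fine_gt0; rewrite ref_simplex_gt0 ref_simplex_lty. Qed.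

Lemma simplex_neq0 : simplex a !=set0.
Proof.
have [x Sx] : @std_simplex R n.+1 !=set0.
  apply/set0P/eqP => S0; have := std_simplex_gt0 R n.+1.
  by rewrite S0 measure0 ltxx.
by exists (of_bary a x); apply/simplex_of_bary.
Qed.

Lemma simplex_thick_face i (t : 'rV[R]_n) :
  @ref_simplex R n t -> thick_at (simplex a) (face_param a i t).
Proof.
rewrite ref_simplexE => t0; have [z Tz] := simplex_neq0.
apply: (@star_thick _ _ _ _ z); first exact: open_simplex.
move=> e /andP[e0 e1]; move: Tz; rewrite simplexE //= => Tz k.
have [c [g [hg ha]]] := bary_to_bary a_nondeg k.
have b0 : 0 <= c + dotp g (face_param a i t).
  rewrite affine_face_param /bary_comb; apply: sumr_ge0 => j _ /=.
  by rewrite ha mulr_ge0.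
have := Tz k; rewrite !hg dotpDr dotpZr dotpBr; nra.
Qed.

(** The points of a closed face are limits of points of the open simplex, so that
the trace of a function almost everywhere equal to a continuous [F] is [F]. The
Gram factor of the surface measure cancels in the mean. *)
Lemma face_meanE j (v F : 'rV[R]_n.+1 -> R) :
  continuous F -> {ae lebesgue_rv n.+1, forall y, simplex a y -> v y = F y} ->
  face_mean a j v = (\int[lebesgue_rv n]_(t in @ref_simplex R n) F (face_param a j t)) / Rv.
Proof.
move=> cF vF.
have G0 : Num.sqrt (\det (face_edges a j *m (face_edges a j)^T)) != 0.
  by rewrite gt_eqF // sqrtr_gt0; exact: face_gram_gt0.
rewrite /face_mean /face_measure /face_integral -mulf_div divff // mul1r; congr (_ / _).
  by apply: eq_Rintegral => t /set_mem St; apply: trace_continuous vF; [exact: simplex_thick_face|exact: cF].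
by rewrite Rintegral_cst ?mul1r //; exact: measurable_ref_simplex.
Qed.

Lemma face_mean_affine_pos j (v : 'rV[R]_n.+1 -> R) c g c' g' (k : R) :
  {ae lebesgue_rv n.+1, forall y, simplex a y -> v y = c + dotp g y + k * Num.max 0 (c' + dotp g' y)} ->
  face_mean a j v = (\sum_m (c + dotp g (a (lift j m)))) / n.+1%:R +
    k * face_mean a j (fun y => Num.max 0 (c' + dotp g' y)).
Proof.
move=> vE.
rewrite (@face_meanE _ _ (fun y => c + dotp g y + k * Num.max 0 (c' + dotp g' y))) //; last first.
  exact: continuous_affine_pos.
rewrite (@face_meanE _ _ (fun y => Num.max 0 (c' + dotp g' y))); last 2 first.
- exact: continuous_pos_affine.
- by apply: aeW.
pose b m := c + dotp g (a (lift j m)); pose b' m := c' + dotp g' (a (lift j m)).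
have -> : \int[lebesgue_rv n]_(t in @ref_simplex R n) (c + dotp g (face_param a j t) +
      k * Num.max 0 (c' + dotp g' (face_param a j t))) =
    \int[lebesgue_rv n]_(t in @ref_simplex R n) (bary_comb b t + k * Num.max 0 (bary_comb b' t)).
  by apply: eq_Rintegral => t _; rewrite !affine_face_param.
have -> : \int[lebesgue_rv n]_(t in @ref_simplex R n) Num.max 0 (c' + dotp g' (face_param a j t)) =
    \int[lebesgue_rv n]_(t in @ref_simplex R n) Num.max 0 (bary_comb b' t).
  by apply: eq_Rintegral => t _; rewrite affine_face_param.
have mS := @measurable_ref_simplex R n.
have Ib' := @integrable_pos_bary_comb R n b'.
rewrite RintegralD //; last 2 first.
- exact: integrable_bary_comb.
- apply: (integrable_ref_simplex (K := `|k| * \sum_m `|b' m|)).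
    by apply: measurable_funM => //; exact: measurable_pos_bary_comb.
  move=> x Sx; rewrite normrM ler_wpM2l //; apply: le_trans (bary_comb_bound b' Sx).
  by case: (leP 0 (bary_comb b' x)) => // _; rewrite normr0.
rewrite RintegralZl // integral_bary_comb mulrDl mulrA; congr (_ + _).
have := Rv_gt0; rewrite /Rv ref_simplex_std.
set s := fine _ => s0; rewrite invfM mulrACA divff ?mulr1 //.
by apply: contraTneq s0 => ->; rewrite mulr0 ltxx.
Qed.

Lemma face_mean_affine j (v : 'rV[R]_n.+1 -> R) c g :
  (forall y, simplex a y -> v y = c + dotp g y) ->
  face_mean a j v = (\sum_m (c + dotp g (a (lift j m)))) / n.+1%:R.
Proof.
move=> vE; rewrite (@face_mean_affine_pos j v c g 0 0 0) ?mul0r ?addr0 //.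
by apply: aeW => y Ty; rewrite vE // mul0r addr0.
Qed.

End crouzeix_raviart.

(** * Measure of a cut simplex *)

Section simplex_measure.
Context (R : realType) (n : nat) (a : 'I_n.+2 -> 'rV[R]_n.+1).
Context (a_nondeg : Defs.nondegenerate a).
Implicit Types (x y g : 'rV[R]_n.+1) (k i j : 'I_n.+2) (c : R).

Lemma affine_bounded c g y : simplex a y ->
  `|c + dotp g y| <= \sum_k `|c + dotp g (a k)|.
Proof.
rewrite simplexE // => Ty.
have := @bary_comb_bound R n.+1 (fun k => c + dotp g (a k)) (to_bary a y).
by rewrite -affine_of_bary to_baryK //; apply; rewrite ref_simplexE => k; exact/ltW/Ty.
Qed.

Lemma simplex_lty : (lebesgue_rv n.+1 (simplex a) < +oo)%E.
Proof.
pose K := \sum_j \sum_k `|0 + dotp (delta_mx 0 j : 'rV[R]_n.+1) (a k)|.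
have K0 : 0 < 1 + K by rewrite ltr_wpDr // sumr_ge0 // => j _; apply: sumr_ge0.
apply: (@le_lt_trans _ _ (lebesgue_rv n.+1 (ball (0 : 'rV[R]_n.+1) (1 + K)))); last first.
  by rewrite lebesgue_rv_ball // ltry.
apply: le_measure; rewrite ?inE.
- exact: measurable_simplex.
- exact: measurable_ball_rv.
move=> y Ty; split => // i j; rewrite ord1 mxE -ball_normE /= sub0r normrN.
have -> : y 0 j = 0 + dotp (delta_mx 0 j) y.
  rewrite add0r dotpE (bigD1 j) //= mxE !eqxx mul1r big1 ?addr0 // => k kj.
  by rewrite mxE (negbTE kj) andbF mul0r.
apply: (le_lt_trans (affine_bounded 0 (delta_mx 0 j) Ty)).
rewrite /K (bigD1 j) //= addrCA ltrDl ltr_wpDr // sumr_ge0 // => k _.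
by apply: sumr_ge0.
Qed.

Lemma simplex_gt0 : (0 < lebesgue_rv n.+1 (simplex a))%E.
Proof.
have [z Tz] := simplex_neq0 a_nondeg.
rewrite lt_neqAle measure_ge0 andbT eq_sym; apply/eqP => T0.
apply: (@open_not_negligible _ _ (simplex a) z).
  by apply: open_nbhs_nbhs; split => //; exact: open_simplex.
by apply/negligibleP; [exact: measurable_simplex|].
Qed.

Lemma measurable_cut_simplex c g : measurable (simplex a `&` [set y | 0 < c + dotp g y]).
Proof.
apply: measurableI; first exact: measurable_simplex.
by apply: measurable_pos_preimage; exact: measurable_affine.
Qed.

Lemma cut_simplex_lty c g :
  (lebesgue_rv n.+1 (simplex a `&` [set y | (0 < c + dotp g y)%R]) < +oo)%E.
Proof.
apply: (le_lt_trans _ simplex_lty); apply: le_measure; rewrite ?inE //.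
- exact: measurable_cut_simplex.
- exact: measurable_simplex.
Qed.

(** The Jacobian of [of_bary] is the same for the simplex and for the part cut
off. *)
Lemma cut_simplex_ratio c g :
  fine (lebesgue_rv n.+1 (simplex a `&` [set y | 0 < c + dotp g y])) /
    fine (lebesgue_rv n.+1 (simplex a)) =
  fine (lebesgue_rv n.+1 (@std_simplex R n.+1 `&` [set x | 0 < bary_comb (fun k => c + dotp g (a k)) x])) /
    fine (lebesgue_rv n.+1 (@std_simplex R n.+1)).
Proof.
pose l k := c + dotp g (a k); rewrite -/l.
have mTp := measurable_cut_simplex c g.
have := lebesgue_rv_affine_preimage (measurable_of_bary a) (of_baryD a_nondeg)
  mTp (measurable_simplex a_nondeg).
have -> : of_bary a @^-1` simplex a = @std_simplex R n.+1.
  by apply/seteqP; split => x; [move/(simplex_of_bary a_nondeg)|move=> ?; exact/(simplex_of_bary a_nondeg)].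
have -> : of_bary a @^-1` (simplex a `&` [set y | 0 < c + dotp g y]) =
    @std_simplex R n.+1 `&` [set x | 0 < bary_comb l x].
  apply/seteqP; split => x /= [Sx]; rewrite affine_of_bary => lx; split => //.
    exact/(simplex_of_bary a_nondeg).
  exact/(simplex_of_bary a_nondeg).
have f1 := cut_simplex_lty c g.
have f2 : (lebesgue_rv n.+1 (@std_simplex R n.+1 `&` [set x | (0 < bary_comb l x)%R]) < +oo)%E.
  apply: (le_lt_trans _ (std_simplex_lty R n.+1)); apply: le_measure; rewrite ?inE //.
  - apply: measurableI; first exact: measurable_std_simplex.
    by apply: measurable_pos_preimage; exact: measurable_bary_comb.
  - exact: measurable_std_simplex.
have g1 : 0 < fine (lebesgue_rv n.+1 (simplex a)) by apply: fine_gt0; rewrite simplex_gt0 simplex_lty.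
have g2 : 0 < fine (lebesgue_rv n.+1 (@std_simplex R n.+1)).
  by apply: fine_gt0; rewrite std_simplex_gt0 std_simplex_lty.
move=> /(congr1 fine); rewrite !fineM; last 4 first.
- by rewrite ge0_fin_numE // std_simplex_lty.
- by rewrite ge0_fin_numE.
- by rewrite ge0_fin_numE.
- by rewrite ge0_fin_numE // simplex_lty.
move=> E; apply/eqP; rewrite eqr_div; [|exact: lt0r_neq0|exact: lt0r_neq0].
by apply/eqP; rewrite E mulrC.
Qed.

(** This is [simplex_divergence] divided by the measure of the reference face. By
[cut_simplex_ratio] the right-hand side involves the simplex [a] itself. *)
Lemma face_mean_pos_affineB i j c g :
  face_mean a i (fun y => Num.max 0 (c + dotp g y)) - face_mean a j (fun y => Num.max 0 (c + dotp g y)) =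
  (dotp g (a j) - dotp g (a i)) / n.+1%:R *
  (fine (lebesgue_rv n.+1 (simplex a `&` [set y | 0 < c + dotp g y])) /
   fine (lebesgue_rv n.+1 (simplex a))).
Proof.
pose l k := c + dotp g (a k).
have M k : face_mean a k (fun y => Num.max 0 (c + dotp g y)) =
    (\int[lebesgue_rv n]_(t in @ref_simplex R n) Num.max 0 (bary_comb (l \o lift k) t)) /
    fine (lebesgue_rv n (@ref_simplex R n)).
  rewrite (@face_meanE _ _ _ a_nondeg _ _ (fun y => Num.max 0 (c + dotp g y))); last 2 first.
  - exact: continuous_pos_affine.
  - by apply: aeW.
  by congr (_ / _); apply: eq_Rintegral => t _; rewrite affine_face_param.
rewrite !M -mulrBl -simplex_divergence cut_simplex_ratio ref_simplex_std /l invfM.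
by rewrite opprD addrACA subrr add0r -!mulrA; congr (_ * _); rewrite mulrCA.
Qed.

End simplex_measure.

(** * Affine functions with prescribed face means *)

Section crouzeix_raviart_dual.
Context (R : realType) (n : nat) (a : 'I_n.+2 -> 'rV[R]_n.+1).
Context (a_nondeg : Defs.nondegenerate a).
Implicit Types (x y g : 'rV[R]_n.+1) (k i j : 'I_n.+2) (c : R) (m : 'I_n.+2 -> R).

(** The mean of an affine function over the face [j] is the average of its values
at the vertices other than [j]. This linear system is solved by summing all its
equations. *)
Lemma vertex_values_of_means (p m : 'I_n.+2 -> R) :
  (forall j, (\sum_k p (lift j k)) / n.+1%:R = m j) <->
  (forall k, p k = \sum_j m j - n.+1%:R * m k).
Proof.
have n0 : n.+1%:R != 0 :> R by rewrite pnatr_eq0.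
split=> [h k|h j].
  have E j : \sum_k p k - p j = n.+1%:R * m j.
    by rewrite -h mulrC divfK // (bigD1_ord j) //= addrAC subrr add0r.
  have S : \sum_k p k = \sum_j m j.
    apply: (mulfI n0); rewrite [RHS]mulr_sumr; under [RHS]eq_bigr do rewrite -E.
    rewrite sumrB sumr_const card_ord -[X in X - _]mulr_natl -[n.+2%:R]natr1.
    by rewrite mulrDl mul1r addrK.
  by rewrite -S -E subKr.
have -> : \sum_k p (lift j k) = n.+1%:R * m j; last by rewrite mulrC mulKf.
under eq_bigr do rewrite h.
rewrite sumrB sumr_const card_ord -mulr_sumr -[X in X - _]mulr_natl -mulrBr.
by rewrite (bigD1_ord j) //= addrK.
Qed.

Lemma affine_of_means m c g :
  (forall j, face_mean a j (fun y => c + dotp g y) = m j) <->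
  (forall k, c + dotp g (a k) = \sum_j m j - n.+1%:R * m k).
Proof.
rewrite -(vertex_values_of_means (fun k => c + dotp g (a k))).
by split=> h j; have := h j; rewrite (@face_mean_affine R n a a_nondeg j _ c g).
Qed.

(** Covers both [CR_basis] and [CR_interp], which are chosen by [get] among the
affine functions with given face means: there is exactly one of them on the
simplex. *)
Lemma get_P1_of_face_means m : exists c g,
  (forall k, c + dotp g (a k) = \sum_j m j - n.+1%:R * m k) /\
  forall x, simplex a x ->
    get [set p | P1 (simplex a) p /\ forall j, face_mean a j p = m j] x = c + dotp g x.
Proof.
have [c [g hg]] := affine_interpolation a_nondeg (fun k => \sum_j m j - n.+1%:R * m k).
exists c, g; split => // x Tx.
set P := [set p | _].
have [[c' [g' pE]] pm] : P (get P).
  apply: getPex; exists (fun y => c + dotp g y); split; first by exists c, g.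
  exact/affine_of_means.
have [|gg' cc'] := @affine_vertex_inj R n a a_nondeg c' c g' g; last by rewrite pE // gg' cc'.
move=> k; rewrite hg; move: k; apply/affine_of_means => j.
by rewrite -pm !(@face_mean_affine R n a a_nondeg j _ c' g').
Qed.

Lemma grad_affine_near (D : set 'rV[R]_n.+1) (f : 'rV[R]_n.+1 -> R) c g x :
  open D -> D x -> (forall y, D y -> f y = c + dotp g y) -> grad f x = g.
Proof.
move=> oD Dx fE; apply/rowP => j; rewrite mxE.
rewrite (@near_eq_derive _ _ _ f (fun y => c + dotp g y)); last first.
  by near=> y; apply: fE; near: y; exact: open_nbhs_nbhs.
rewrite derive_affine dotpE (bigD1 j) //= mxE !eqxx mulr1 big1 ?addr0 // => i ij.
by rewrite mxE (negbTE ij) andbF mulr0.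
Unshelve. all: by end_near. Qed.

End crouzeix_raviart_dual.

(** * Jumps across the interface *)

Section interface.
Context (R : realType) (n : nat) (a : 'I_n.+2 -> 'rV[R]_n.+1).
Context (a_nondeg : Defs.nondegenerate a) (nu : 'rV[R]_n.+1) (c0 : R).
Context (nu1 : enorm nu = 1).
Implicit Types (x y z g : 'rV[R]_n.+1) (c e : R) (f : 'rV[R]_n.+1 -> R).

Local Notation T := (simplex a).
Local Notation Tp := (Tplus a nu c0).
Local Notation Tm := (Tminus a nu c0).
Local Notation G := (Gamma a nu c0).

Lemma TplusE : Tp = T `&` [set y | 0 < - c0 + dotp nu y].
Proof.
by apply/seteqP; split => y [Ty] /= h; split => //=; move: h; rewrite dotpC addrC subr_gt0.
Qed.

Lemma TminusE : Tm = T `&` [set y | 0 < c0 + dotp (- nu) y].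
Proof.
by apply/seteqP; split => y [Ty] /= h; split => //=; move: h; rewrite dotpNl dotpC subr_gt0.
Qed.

Lemma open_Tplus : open Tp.
Proof. by rewrite TplusE; apply: openI; [exact: open_simplex|exact: open_affine_gt0]. Qed.

Lemma open_Tminus : open Tm.
Proof. by rewrite TminusE; apply: openI; [exact: open_simplex|exact: open_affine_gt0]. Qed.

Lemma simplex_convex x z e : T x -> T z -> 0 < e <= 1 -> T (x + e *: (z - x)).
Proof.
rewrite simplexE // => Tx Tz /andP[e0 e1] k.
have [c [g [hg _]]] := bary_to_bary a_nondeg k.
have := Tx k; have := Tz k; rewrite !hg dotpDr dotpZr dotpBr; nra.
Qed.

Lemma Gamma_thick_plus x : G x -> Tp !=set0 -> thick_at Tp x.
Proof.
move=> [Tx Hx] [z [Tz zp]]; apply: (@star_thick _ _ _ _ z); first exact: open_Tplus.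
move=> e e01; split; first exact: simplex_convex.
move: Hx zp e01; rewrite /hyperplane /= dotpDl dotpZl dotpBl => -> zp /andP[e0 _].
by rewrite ltrDl mulr_gt0 // subr_gt0.
Qed.

Lemma Gamma_thick_minus x : G x -> Tm !=set0 -> thick_at Tm x.
Proof.
move=> [Tx Hx] [z [Tz zm]]; apply: (@star_thick _ _ _ _ z); first exact: open_Tminus.
move=> e e01; split; first exact: simplex_convex.
move: Hx zm e01; rewrite /hyperplane /= dotpDl dotpZl dotpBl => -> zm /andP[e0 _].
by rewrite gtrDl pmulr_rlt0 // subr_lt0.
Qed.

(** The interface lies in a hyperplane, which has measure 0. *)
Lemma ae_off_interface (P : 'rV[R]_n.+1 -> Prop) :
  (forall y, Tp y -> P y) -> (forall y, Tm y -> P y) ->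
  {ae lebesgue_rv n.+1, forall y, T y -> P y}.
Proof.
move=> hp hm; exists (hyperplane nu c0); split.
- exact: measurable_hyperplane.
- apply: lebesgue_rv_hyperplane; apply: contra_eq_neq nu1 => ->.
  by rewrite /enorm dotp0l sqrtr0 eq_sym oner_eq0.
- move=> y /= nP; rewrite /hyperplane /=; apply/eqP/negPn/negP => yc; apply: nP => Ty.
  by have := yc; rewrite neq_lt => /orP[yc'|yc']; [apply: hm|apply: hp].
Qed.

(** The infimum is attained at the orthogonal projection; it is a lower bound by
Cauchy-Schwarz. *)
Lemma edist_hyperplane y : c0 < dotp y nu -> Defs.edist y (hyperplane nu c0) = dotp y nu - c0.
Proof.
move=> yc; have nu11 := enorm_unit nu1.
have lb : lbound [set enorm (y - z) | z in hyperplane nu c0] (dotp y nu - c0).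
  move=> _ [z zc <-]; apply: le_trans (dotp_le_enorm _ nu1).
  by rewrite dotpBl; have -> : dotp z nu = c0 by exact: zc.
have mem : [set enorm (y - z) | z in hyperplane nu c0] (dotp y nu - c0).
  exists (y - (dotp y nu - c0) *: nu); first by rewrite /hyperplane /= dotpBl dotpZl nu11; ring.
  rewrite opprB addrC subrK /enorm dotpZl dotpZr nu11 mulr1 -expr2 sqrtr_sqr ger0_norm //.
  by rewrite subr_ge0 ltW.
apply/eqP; rewrite eq_le; apply/andP; split.
  by apply: ge_inf => //; exists (dotp y nu - c0).
by apply: lb_le_inf => //; exists (dotp y nu - c0).
Qed.

Lemma w_TE y : T y -> w_T a nu c0 y = Num.max 0 (- c0 + dotp nu y).
Proof.
move=> Ty; rewrite /w_T; case: ifPn => [/set_mem [_ /= yc]|/negP yTp].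
  rewrite edist_hyperplane // dotpC addrC; apply/esym/max_idPr.
  by rewrite addrC subr_ge0 dotpC ltW.
apply/esym/max_idPl; rewrite addrC subr_le0 dotpC leNgt; apply/negP => yc.
by apply: yTp; apply: mem_set.
Qed.

Lemma jump_affine f cp gp cm gm x : G x -> Tp !=set0 -> Tm !=set0 ->
  (forall y, Tp y -> f y = cp + dotp gp y) -> (forall y, Tm y -> f y = cm + dotp gm y) ->
  jump a nu c0 f x = (cp + dotp gp x) - (cm + dotp gm x).
Proof.
move=> Gx Tp0 Tm0 fp fm; rewrite /jump; congr (_ - _).
  apply: (@trace_continuous _ _ _ _ (fun y => cp + dotp gp y)).
  - exact: Gamma_thick_plus.
  - exact: continuous_affine.
  - exact: aeW.
apply: (@trace_continuous _ _ _ _ (fun y => cm + dotp gm y)).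
- exact: Gamma_thick_minus.
- exact: continuous_affine.
- exact: aeW.
Qed.

(** [beta_T] and the gradient are constant on either side, because [Tplus] and
[Tminus] are open. *)
Lemma jump_flux bp bm f cp gp cm gm x : G x -> Tp !=set0 -> Tm !=set0 ->
  (forall y, Tp y -> f y = cp + dotp gp y) -> (forall y, Tm y -> f y = cm + dotp gm y) ->
  jump a nu c0 (fun y => beta_T a nu c0 bp bm y * dotp (grad f y) nu) x =
  bp * dotp gp nu - bm * dotp gm nu.
Proof.
move=> Gx Tp0 Tm0 fp fm.
have E y : Tp y -> beta_T a nu c0 bp bm y * dotp (grad f y) nu = bp * dotp gp nu.
  move=> Ty; rewrite /beta_T mem_set //.
  by rewrite (grad_affine_near open_Tplus Ty fp).
have E' y : Tm y -> beta_T a nu c0 bp bm y * dotp (grad f y) nu = bm * dotp gm nu.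
  move=> Ty; rewrite /beta_T memNset; last first.
    by case: Ty => _ /= yc [_ /= yc']; have := lt_trans yc yc'; rewrite ltxx.
  by rewrite (grad_affine_near open_Tminus Ty fm).
rewrite (@jump_affine _ (bp * dotp gp nu) 0 (bm * dotp gm nu) 0) ?dotp0l ?addr0 //.
- by move=> y Ty; rewrite E // dotp0l addr0.
- by move=> y Ty; rewrite E' // dotp0l addr0.
Qed.

(** Moving from a point of the interface in a direction orthogonal to [nu] stays in
the interface for a while; so the gradient has no component orthogonal to
[nu]. *)
Lemma affine_zero_on_Gamma c g : G !=set0 ->
  (forall x, G x -> c + dotp g x = 0) ->
  exists k, forall y, c + dotp g y = k * (- c0 + dotp nu y).
Proof.
move=> [x0 [Tx0 Hx0]] h; have nu11 := enorm_unit nu1.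
have x0c : dotp nu x0 = c0 by rewrite dotpC.
pose v := g - dotp g nu *: nu.
have vnu : dotp v nu = 0 by rewrite /v dotpBl dotpZl nu11; ring.
have /nbhs_ballP[r /= r0 rT] : nbhs x0 T by apply: open_nbhs_nbhs; split; [exact: open_simplex|].
have [e /andP[e0 _] xe] := small_step x0 v r0.
have gv : dotp g v = 0.
  have : G (x0 + e *: v).
    by split; [exact: rT | rewrite /hyperplane /= dotpDl dotpZl vnu mulr0 addr0 dotpC].
  move=> /h; rewrite dotpDr dotpZr addrA h; last by split.
  by rewrite add0r => /eqP; rewrite mulf_eq0 gt_eqF // => /eqP.
have v0 : v = 0.
  by apply: dotp_eq0; rewrite {1}/v dotpBl dotpZl gv (dotpC nu) vnu; ring.
exists (dotp g nu) => y.
have gE : g = dotp g nu *: nu by apply/eqP; rewrite -subr_eq0 -/v v0.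
have : c + dotp g x0 = 0 by apply: h; split.
by rewrite gE !dotpZl nu11 x0c => hc; rewrite mulr1; lra.
Qed.

End interface.

(** * The immersed finite element basis *)

Lemma L2_affine_pos (R : realType) n (a : 'I_n.+2 -> 'rV[R]_n.+1) c g c' g' (k : R) :
  Defs.nondegenerate a ->
  L2 (simplex a) (fun y => c + dotp g y + k * Num.max 0 (c' + dotp g' y)).
Proof.
move=> a_nondeg; pose F y := c + dotp g y + k * Num.max 0 (c' + dotp g' y).
have mF : measurable_fun setT F.
  apply: measurable_funD; first exact: measurable_affine.
  apply: measurable_funM => //; apply: measurable_maxr => //; exact: measurable_affine.
split; first exact: measurable_funTS.
pose K := \sum_k `|c + dotp g (a k)| + `|k| * \sum_k `|c' + dotp g' (a k)|.
have FK y : simplex a y -> `|F y| <= K.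
  move=> Ty; apply: le_trans (ler_normD _ _) _; apply: lerD; first exact: affine_bounded.
  rewrite normrM ler_wpM2l //; apply: le_trans (affine_bounded a_nondeg c' g' Ty).
  by case: (leP 0 (c' + dotp g' y)) => // _; rewrite normr0.
apply: (@le_lt_trans _ _ (\int[lebesgue_rv n.+1]_(x in simplex a) cst (K ^+ 2)%:E x)%E).
  apply: ge0_le_integral => //.
  - exact: measurable_simplex.
  - by move=> y _; rewrite lee_fin sqr_ge0.
  - by apply/measurable_EFinP/measurable_funTS; exact: measurable_funX.
  - move=> y Ty; rewrite lee_fin -[X in X <= _]real_normK ?num_real //.
    by rewrite ler_pXn2r ?nnegrE // ?FK // (le_trans _ (FK _ Ty)).
rewrite integral_cst; last exact: measurable_simplex.
by rewrite lte_mul_pinfty ?lee_fin ?sqr_ge0 // simplex_lty.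
Qed.

Lemma cut_ratio01 (R : realType) n (a : 'I_n.+2 -> 'rV[R]_n.+1) c g :
  Defs.nondegenerate a ->
  0 <= fine (lebesgue_rv n.+1 (simplex a `&` [set y | 0 < c + dotp g y])) /
         fine (lebesgue_rv n.+1 (simplex a)) <= 1.
Proof.
move=> a_nondeg.
have T0 : 0 < fine (lebesgue_rv n.+1 (simplex a)) by apply: fine_gt0; rewrite simplex_gt0 // simplex_lty.
rewrite divr_ge0 ?fine_ge0 ?measure_ge0 //= ler_pdivrMr // mul1r.
apply: fine_le.
- by rewrite ge0_fin_numE // cut_simplex_lty.
- by rewrite ge0_fin_numE // simplex_lty.
apply: le_measure; rewrite ?inE //.
- exact: measurable_cut_simplex.
- exact: measurable_simplex.
Qed.

(** The heart of the explicit formula: for the interpolation of the positive part,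
[grad . nu] is |T+| / |T|. By [face_mean_pos_affineB] the interpolation differs
by a constant from |T+| / |T| times the affine function [- c + dotp nu y], whose
slope along [nu] is 1. *)
Lemma interp_pos_slope (R : realType) n (a : 'I_n.+2 -> 'rV[R]_n.+1) nu c cq gq :
  Defs.nondegenerate a -> enorm nu = 1 ->
  let m j := face_mean a j (fun y => Num.max 0 (- c + dotp nu y)) in
  (forall k, cq + dotp gq (a k) = \sum_j m j - n.+1%:R * m k) ->
  dotp gq nu =
    fine (lebesgue_rv n.+1 (simplex a `&` [set y | 0 < - c + dotp nu y])) /
    fine (lebesgue_rv n.+1 (simplex a)).
Proof.
move=> a_nondeg nu1 m qv; set th := (X in _ = X).
have [|-> _] := @affine_vertex_inj R n a a_nondeg
    cq (cq + dotp gq (a ord0) - th * dotp nu (a ord0)) gq (th *: nu).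
  move=> k; have mB : m ord0 - m k = _ := face_mean_pos_affineB a_nondeg ord0 k (- c) nu.
  rewrite -/th in mB.
  have E : n.+1%:R * (m ord0 - m k) = th * (dotp nu (a k) - dotp nu (a ord0)).
    have N0 : n.+1%:R != 0 :> R by rewrite pnatr_eq0.
    by move: mB N0; set N := n.+1%:R => -> N0; field.
  by move: E (qv k) (qv ord0); rewrite dotpZl mulrBr; lra.
by rewrite dotpZl (enorm_unit nu1) mulr1.
Qed.

Theorem theorem4p2 (R : realType) (n : nat) (hN : n.+1 = 2%N \/ n.+1 = 3%N)
    (a : 'I_n.+2 -> 'rV[R]_n.+1) (nu : 'rV[R]_n.+1) (c : R)
    (hT : interface_element a nu c)
    (bp bm : R) (hbp : 0 < bp) (hbm : 0 < bm) (i : 'I_n.+2) :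
  exists phi : 'rV[R]_n.+1 -> R,
    [/\ S_h a nu c bp bm phi,
        forall j, face_mean a j phi = (i == j)%:R,
        forall psi, S_h a nu c bp bm psi ->
          (forall j, face_mean a j psi = (i == j)%:R) ->
          {ae lebesgue_rv n.+1, forall x, simplex a x -> psi x = phi x}
      & forall x, simplex a x ->
          phi x = CR_basis a i x +
            (bm / bp - 1) * dotp (grad (CR_basis a i) x) nu /
            (1 + (bm / bp - 1) *
               (fine (lebesgue_rv n.+1 (Tplus a nu c)) /
                fine (lebesgue_rv n.+1 (simplex a)))) *
            (w_T a nu c x - CR_interp a (w_T a nu c) x)].
Proof.
have [a_nondeg nu1 G0 Tp0 Tm0] := hT; have nu11 := enorm_unit nu1.
pose W y := Num.max 0 (- c + dotp nu y).
pose m j := face_mean a j (w_T a nu c).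
have mW j : m j = face_mean a j W.
  rewrite /m (@face_mean_affine_pos _ _ _ a_nondeg j _ 0 0 (- c) nu 1) /=.
    by rewrite big1 ?mul0r ?add0r ?mul1r // => k _; rewrite dotp0l addr0.
  by apply: aeW => y Ty; rewrite w_TE // dotp0l !add0r mul1r.
have [cl [gl [lv lE]]] := get_P1_of_face_means a_nondeg (fun j => (i == j)%:R : R).
have [cq [gq [qv qE]]] := get_P1_of_face_means a_nondeg m.
rewrite TplusE.
pose th := fine (lebesgue_rv n.+1 (simplex a `&` [set y | 0 < - c + dotp nu y])) /
           fine (lebesgue_rv n.+1 (simplex a)).
rewrite -/th.
have /andP[th0 th1] : 0 <= th <= 1 by exact: cut_ratio01.
have gqE : dotp gq nu = th.
  apply: (interp_pos_slope a_nondeg nu1 (cq := cq)) => k; rewrite qv mW.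
  by congr (_ - _); apply: eq_bigr => j _; exact: mW.
have Wp y : Tplus a nu c y -> W y = - c + dotp nu y.
  by move=> [_ /= yc]; apply/max_idPr; rewrite addrC subr_ge0 dotpC ltW.
have Wm y : Tminus a nu c y -> W y = 0.
  by move=> [_ /= yc]; apply/max_idPl; rewrite addrC subr_le0 dotpC ltW.
pose s := dotp gl nu; pose k := (bm / bp - 1) * s / (1 + (bm / bp - 1) * th).
have bp0 : bp != 0 by rewrite gt_eqF.
(* A convex combination of [bp] and [bm], as [th] is in [0, 1]. *)
have den0 : 0 < bp + (bm - bp) * th by nra.
have kP q : q = k <-> q * (bp + (bm - bp) * th) = (bm - bp) * s.
  have -> : k = (bm - bp) * s / (bp + (bm - bp) * th).
    by rewrite /k; field; rewrite bp0 gt_eqF.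
  by split=> [->|<-]; rewrite ?divfK ?mulfK // gt_eqF.
have AE q v : (cl - q * cq) + dotp (gl - q *: gq) (a v) =
    \sum_j ((i == j)%:R - q * m j) - n.+1%:R * ((i == v)%:R - q * m v).
  rewrite sumrB -mulr_sumr dotpBl dotpZl.
  by have := lv v; have := qv v; move=> /(congr1 (fun z => q * z)); lra.
(* [q] stands for the slope jump of a candidate function: [kP] solves the flux
   condition for it, and [AE] gives the vertex values of the affine part that
   the face means then force. *)
pose phi y := (cl - k * cq) + dotp (gl - k *: gq) y + k * W y.
have phip y : Tplus a nu c y ->
    phi y = (cl - k * cq - k * c) + dotp (gl - k *: gq + k *: nu) y.
  by move=> /Wp; rewrite /phi => ->; rewrite [X in _ = _ + X]dotpDl dotpZl; ring.
have phim y : Tminus a nu c y -> phi y = (cl - k * cq) + dotp (gl - k *: gq) y.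
  by move=> /Wm; rewrite /phi => ->; rewrite mulr0 addr0.
exists phi; split.
- split.
  + exact: L2_affine_pos.
  + by exists (cl - k * cq - k * c), (gl - k *: gq + k *: nu).
  + by exists (cl - k * cq), (gl - k *: gq).
  + move=> x Gx; rewrite (jump_affine a_nondeg Gx Tp0 Tm0 phip phim).
    have [_ xc] := Gx; rewrite dotpDl dotpZl (dotpC nu) (_ : dotp x nu = c) //; ring.
  + move=> x Gx; rewrite (jump_flux a_nondeg bp bm Gx Tp0 Tm0 phip phim).
    rewrite !dotpDl !dotpNl !dotpZl gqE nu11 -/s.
    by have := (kP k).1 erefl; lra.
- move=> j; rewrite (@face_mean_affine_pos _ _ _ a_nondeg j _ (cl - k * cq) (gl - k *: gq) (- c) nu k) /=.
    have := (vertex_values_of_means _ _).2 (AE k) j => -> /=.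
    by rewrite -/W -mW subrK.
  exact: aeW.
- move=> psi [_ [cp [gp pp]] [cm [gm pm]] psij psif] psim.
  have [x0 Gx0] := G0.
  have [q hq] : exists q, forall y, (cp - cm) + dotp (gp - gm) y = q * (- c + dotp nu y).
    apply: (affine_zero_on_Gamma a_nondeg nu1 G0) => x Gx.
    have := psij x Gx; rewrite (jump_affine a_nondeg Gx Tp0 Tm0 pp pm) dotpBl; lra.
  have gpE : dotp gp nu = dotp gm nu + q.
    have [|gE _] := @affine_vertex_inj R n a a_nondeg (cp - cm) (- (q * c)) (gp - gm) (q *: nu).
      by move=> v; rewrite hq dotpZl; ring.
    by have := congr1 (fun u => dotp u nu) gE; rewrite dotpBl dotpZl nu11; lra.
  have psiE : {ae lebesgue_rv n.+1, forall y, simplex a y -> psi y = cm + dotp gm y + q * W y}.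
    apply: (@ae_off_interface _ _ a nu c nu1) => y Ty.
      by rewrite (Wp y Ty) (pp y Ty); have := hq y; rewrite dotpBl; lra.
    by rewrite (Wm y Ty) mulr0 addr0 (pm y Ty).
  have [|gmE cmE] := @affine_vertex_inj R n a a_nondeg cm (cl - q * cq) gm (gl - q *: gq).
    move=> v; rewrite AE; move: v.
    apply: (vertex_values_of_means (fun v => cm + dotp gm (a v)) _).1 => j /=.
    have := psim j; rewrite (@face_mean_affine_pos _ _ _ a_nondeg j psi cm gm (- c) nu q psiE).
    by rewrite -/W -mW => <-; rewrite addrK.
  have qk : q = k.
    apply/kP; have := psif x0 Gx0; rewrite (jump_flux a_nondeg bp bm Gx0 Tp0 Tm0 pp pm).
    by rewrite gpE gmE dotpBl dotpZl gqE -/s; lra.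
  by apply: filterS psiE => y h Ty; rewrite h // /phi cmE gmE qk.
- move=> x Tx; rewrite w_TE //.
  have -> : CR_basis a i x = cl + dotp gl x by exact: lE.
  have -> : CR_interp a (w_T a nu c) x = cq + dotp gq x by exact: qE.
  rewrite (grad_affine_near (open_simplex a_nondeg) Tx lE).
  rewrite [_ / (1 + _)](_ : _ = k) // /phi dotpBl dotpZl -/(W x).
  by move: (W x) => Wx; ring.
Qed.
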